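(* Let $\mu$ be a balanced measure on $\mathbb{R}$, $w$ a weight, $p\in(1,\infty)$, and $N\ge1$ an integer. The operator $\mathcal{M}^N$ is bounded on $L^p(w\,d\mu)$ if and only if $w\in A_p^b(\mu)$. Moreover, $\mathcal{M}^N$ is bounded from $L^1(w\,d\mu)$ to $L^{1,\infty}(w\,d\mu)$ if and only if $w\in A_1^b(\mu)$.
   Context: $\mathscr{D}$ is the standard dyadic system of half-open intervals $2^{-k}[j,j+1)$, $j,k\in\mathbb{Z}$. For $I\in\mathscr{D}$, $I_-$ and $I_+$ are its left and right dyadic children, $\widehat{I}$ its dyadic parent, $I^b$ its dyadic sibling (the other child of $\widehat{I}$), $I^b_\pm$ the right/left children of $I^b$, and $I^{(j)}$ its $j$-th dyadic ancestor ($I^{(0)}=I$). The dyadic distance is $\operatorname{dist}_{\mathscr{D}}(I,J)=\min\{s+t:\ s,t\ge0,\ I^{(s)}=J^{(t)}\}$, and $=\infty$ if $I,J$ have no common dyadic ancestor. $\mu$ is a Borel measure on $\mathbb{R}$ with $0<\mu(I)<\infty$ for all $I\in\mathscr{D}$; $\langle f\rangle_I=\mu(I)^{-1}\int_I f\,d\mu$ and $m(I)=\mu(I_-)\mu(I_+)/\mu(I)$. The measure $\mu$ is balanced if it has no atoms and there is $c\ge1$ with $c^{-1}m(\widehat{I})\le m(I)\le c\,m(\widehat{I})$ for all $I\in\mathscr{D}$. A weight is a $\mu$-a.e. positive function $w\in L^1_{\mathrm{loc}}(\mu)$; $p'$ is the conjugate exponent of $p$. For $1\le p<\infty$: $c_p^b(I,J)=1$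 if $I=J$ and $c_p^b(I,J)=\frac{m(I)^{p/2}m(J)^{p/2}}{\mu(J)\mu(I)^{p-1}}$ otherwise. The maximal operator is $\mathcal{M}^Nf(x)=\sup c_1^b(I,J)\langle|f|\rangle_I1_J(x)$ over $I,J\in\mathscr{D}$ with $\operatorname{dist}_{\mathscr{D}}(I,J)\le N+2$. For $1<p<\infty$, $w\in A_p^b(\mu)$ means $\sup c_p^b(I,J)\langle w\rangle_I\langle w^{1-p'}\rangle_J^{p-1}<\infty$, and $w\in A_1^b(\mu)$ means $\sup c_1^b(I,J)\langle w\rangle_I\|w^{-1}\|_{L^\infty(J)}<\infty$, where both suprema are over $I,J\in\mathscr{D}$ with $J\in\{I,I^b_-,I^b_+\}$ or $I\in\{J^b_-,J^b_+\}$. *)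

(* Defs.v *)
From HB Require Import structures.
From mathcomp Require Import all_boot all_order all_algebra.
From mathcomp Require Import all_classical all_reals all_analysis.
Set Implicit Arguments.
Unset Strict Implicit.
Unset Printing Implicit Defensive.
Import Order.TTheory GRing.Theory Num.Theory.
Import numFieldNormedType.Exports.

Local Open Scope classical_set_scope.
Local Open Scope ring_scope.

(* The pair (k, j) encodes the dyadic interval 2^-k [j, j + 1[; distinct pairs
   encode distinct intervals. *)
Definition dyadic : Type := (int * int)%type.

(* [(_ %/ _)%Z] rounds down for a positive divisor, also for negative j. *)
Definition dparent (I : dyadic) : dyadic := (I.1 - 1, (I.2 %/ 2)%Z).
Definition dleft (I : dyadic) : dyadic := (I.1 + 1, 2 * I.2).
Definition dright (I : dyadic) : dyadic := (I.1 + 1, 2 * I.2 + 1).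
Definition dsibling (I : dyadic) : dyadic :=
  if I == dleft (dparent I) then dright (dparent I) else dleft (dparent I).
Definition dancestor (n : nat) (I : dyadic) : dyadic := iter n dparent I.

(* An infimum of natural numbers, hence attained when it is finite; it is +oo
   when there is no common ancestor. *)
Definition ddist (R : realType) (I J : dyadic) : \bar R :=
  ereal_inf [set d | exists s t : nat,
    dancestor s I = dancestor t J /\ d = (s + t)%:R%:E].

Definition dyadic_set (R : realType) (I : dyadic) : set (measurableTypeR R) :=
  [set x : R | 2 ^ (- I.1) * I.2%:~R <= x < 2 ^ (- I.1) * (I.2 + 1)%:~R].

Section BalancedMeasures.
Variables (R : realType) (mu : {measure set (measurableTypeR R) -> \bar R}).
Implicit Types (I J : dyadic) (f w : R -> R) (g : R -> \bar R) (p : R).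
Implicit Types N : nat.

Definition dmass I : R := fine (mu (@dyadic_set R I)).

Definition dm I : R := dmass (dleft I) * dmass (dright I) / dmass I.

Definition dyadic_nondegenerate : Prop :=
  forall I, (0 < mu (@dyadic_set R I) < +oo)%E.

Definition is_atom (A : set (measurableTypeR R)) : Prop :=
  [/\ measurable A, (0 < mu A)%E &
      forall B : set (measurableTypeR R), measurable B -> B `<=` A ->
        mu B = 0%E \/ mu (A `\` B) = 0%E].

Definition balanced : Prop :=
  (forall A, ~ is_atom A) /\
  exists c : R, 1 <= c /\
    forall I, c^-1 * dm (dparent I) <= dm I <= c * dm (dparent I).

Definition weight w : Prop :=
  [/\ measurable_fun [set: measurableTypeR R] (w : measurableTypeR R -> R),
      {ae mu, forall x, 0 < w x} &
      forall K : set R, compact K ->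
        (\int[mu]_(x in (K : set (measurableTypeR R))) `|w x|%:E < +oo)%E].

Definition daverage f I : \bar R :=
  ((dmass I)^-1%:E * \int[mu]_(x in @dyadic_set R I) (f x)%:E)%E.

Definition cb p I J : R :=
  if I == J then 1
  else dm I `^ (p / 2) * dm J `^ (p / 2) / (dmass J * dmass I `^ (p - 1)).

Definition dmaximal N f : R -> \bar R := fun x =>
  ereal_sup [set y | exists I J : dyadic,
    (ddist R I J <= (N + 2)%:R%:E)%E /\
    y = ((cb 1 I J)%:E * daverage (fun z => `|f z|%R) I
         * (\1_(@dyadic_set R J) x)%:E)%E].

Definition conjugate_exponent p : R := p / (p - 1).

Definition b_related I J : Prop :=
  [\/ J = I, J = dleft (dsibling I) | J = dright (dsibling I)] \/
  (I = dleft (dsibling J) \/ I = dright (dsibling J)).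

(* On the null set where w is not positive, [`^] and [^-1] take junk values. *)
Definition Apb p w : Prop :=
  (ereal_sup [set y | exists I J : dyadic, b_related I J /\
     y = (cb p I J)%:E * daverage w I *
         daverage (fun z => w z `^ (1 - conjugate_exponent p))%R J `^ (p - 1)]
   < +oo)%E.

Definition A1b w : Prop :=
  (ereal_sup [set y | exists I J : dyadic, b_related I J /\
     y = (cb 1 I J)%:E * daverage w I *
         'N[mu]_+oo[(fun x : measurableTypeR R => ((w x)^-1)%:E)
                      \_ (@dyadic_set R J)]]
   < +oo)%E.

(* Norm of L^p(w dmu) and quasinorm of L^{1,oo}(w dmu). *)
Definition wLnorm w p g : \bar R :=
  ((\int[mu]_x (`|g x| `^ p * (w x)%:E)) `^ p^-1)%E.

Definition wweakL1norm w g : \bar R :=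
  ereal_sup [set y | exists t : R, 0 < t /\
    y = (t%:E * \int[mu]_(x in [set x : measurableTypeR R | t%:E < `|g x|])
                  (w x)%:E)%E].

Definition in_wLp w p f : Prop :=
  measurable_fun [set: measurableTypeR R] (f : measurableTypeR R -> R) /\
  (wLnorm w p (EFin \o f) < +oo)%E.

Definition bounded_on_wLp (M : (R -> R) -> R -> \bar R) w p : Prop :=
  exists C : R, 0 <= C /\ forall f, in_wLp w p f ->
    (wLnorm w p (M f) <= C%:E * wLnorm w p (EFin \o f))%E.

Definition bounded_wL1_weak (M : (R -> R) -> R -> \bar R) w : Prop :=
  exists C : R, 0 <= C /\ forall f, in_wLp w 1 f ->
    (wweakL1norm w (M f) <= C%:E * wLnorm w 1 (EFin \o f))%E.

End BalancedMeasures.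

(* Main.v *)
(* Write W = w mu and let S be the (p-1)-st power of the mass of the dual weight, or
   the norm of 1/w in L^oo when p = 1. For I and J with the common ancestor K at
   bounded distance, A_p^b forces an alternative: either m(K) mu(K) <= C mu(I) mu(J),
   and then the term of (I, J) in the maximal function is at most C <|f|>_K, or
   W(J) <= C W(I). In the second case J lies in a bounded enlargement of I, so the
   enlargements of the intervals on which the dyadic averages exceed t have W-measure
   at most C times that of their union. Hence W{M^N f > C t} <= C W{M^d f > t} for the
   dyadic maximal function M^d. For p = 1 the weak bound for M^d follows by summing
   over maximal intervals. For p > 1, Lerner's pointwise estimate bounds (M^d f)^(p-1)
   by M_w^d(M_sigma^d(f/sigma)^(p-1)/w), and both maximal functions on the right are bounded
   by Doob's inequality, proved here by a Bellman induction along the dyadic tree.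
   Conversely, testing M^N on truncations of the dual weight, or for p = 1 on the
   sets {1/w > a}, restricted to J gives the conditions, because passing from (I, J)
   to (J, I) exchanges the roles of w and its dual. *)
Require Import Defs.
From HB Require Import structures.
From mathcomp Require Import all_boot all_order all_algebra.
From mathcomp Require Import all_classical all_reals all_analysis.
From mathcomp Require Import measurable_realfun.
From mathcomp Require Import ring lra.
From mathcomp Require Import zify.
Set Implicit Arguments.
Unset Strict Implicit.
Unset Printing Implicit Defensive.
Import Order.TTheory GRing.Theory Num.Theory.
Import numFieldNormedType.Exports.
Local Open Scope classical_set_scope.
Local Open Scope ring_scope.

(** The measure need not be doubling: an interval can be much lighter than its parent, so masses
    cannot simply be passed between neighbours. What survives is that the lighter of two siblings
    has mass at most twice the m of their parent, and that balancedness makes m comparable, up to a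
    power of c, at bounded dyadic distance. Passages between I and J are therefore routed through a
    light sibling; when this leads to a child of a sibling, the off-diagonal pairs of A_p^b compare
    the W-masses. About S the dichotomy uses only monotonicity, V^p <= W S and the A_p^b bounds, so
    one argument serves p = 1 and p > 1. The alternative W(J) <= C W(I) is enough because for I and
    J distinct the coefficient is at most c^(2n) with n = N + 2, so that I itself already has a
    large average, and because only boundedly many J are near a given I. *)

(** * The tree of dyadic intervals *)

Section DyadicIntervals.
Variable R : realType.
Implicit Types (I J K : dyadic) (x : R) (k : int).

Lemma dparent_left I : dparent (dleft I) = I.
Proof. by case: I => k j; rewrite /dparent /dleft /= addrK mulKz. Qed.

Lemma dparent_right I : dparent (dright I) = I.
Proof.
case: I => k j; rewrite /dparent /dright /= addrK mulrC divzMDl //.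
by rewrite divz_small ?addr0.
Qed.

Lemma dchild_parent I : I = dleft (dparent I) \/ I = dright (dparent I).
Proof.
case: I => k j; rewrite /dparent /dleft /dright /= subrK.
have := divz_eq j 2; have := modz_ge0 j (isT : 2 != 0 :> int).
have := ltz_pmod j (isT : 0 < 2 :> int).
case: (modz j 2) => // -[|[|//]] _ _ jE; [left|right]; congr pair.
  by rewrite {1}jE addr0 mulrC.
by rewrite {1}jE mulrC.
Qed.

Lemma dleft_neq_right I J : dleft I <> dright J.
Proof. by case: I J => k j [k' j']; rewrite /dleft /dright /= => -[_]; lia. Qed.

Lemma dsibling_left I : dsibling (dleft I) = dright I.
Proof. by rewrite /dsibling dparent_left eqxx. Qed.

Lemma dsibling_right I : dsibling (dright I) = dleft I.
Proof.
rewrite /dsibling dparent_right; case: eqP => // /esym; exact: dleft_neq_right.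
Qed.

Lemma dsiblingK I : dsibling (dsibling I) = I.
Proof.
case: (dchild_parent I) => ->.
  by rewrite dsibling_left dsibling_right.
by rewrite dsibling_right dsibling_left.
Qed.

Lemma dparent_sibling I : dparent (dsibling I) = dparent I.
Proof.
rewrite /dsibling; case: ifP => _; first exact: dparent_right.
exact: dparent_left.
Qed.

Lemma dancestorS n I : dancestor n.+1 I = dancestor n (dparent I).
Proof. by rewrite /dancestor iterSr. Qed.

Lemma dancestorD n m I : dancestor (n + m) I = dancestor n (dancestor m I).
Proof. by rewrite /dancestor iterD. Qed.

Lemma dancestor1 n I : (dancestor n I).1 = I.1 - n%:Z.
Proof.
elim: n => [|n IH]; first by rewrite subr0.
by rewrite [LHS]/= IH; lia.
Qed.

Definition dyadic_at k x : dyadic := (k, Num.floor (2 ^ k * x)).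

Lemma dyadic_set_scaled I x :
  dyadic_set I x <-> I.2%:~R <= 2 ^ I.1 * x < (I.2 + 1)%:~R.
Proof.
have k0 : (0 : R) < 2 ^ I.1 by rewrite exprz_gt0.
rewrite /dyadic_set /= -invr_expz ![_^-1 * _]mulrC ler_pdivrMr //.
by rewrite ltr_pdivlMr // [x * _]mulrC.
Qed.

Lemma dyadic_setP I x : dyadic_set I x <-> dyadic_at I.1 x = I.
Proof.
rewrite dyadic_set_scaled; case: I => k j; rewrite /dyadic_at /=.
split => [h|[<-]]; last by rewrite floor_le floorD1_gt.
by congr pair; apply/eqP; rewrite floor_eq.
Qed.

Lemma dyadic_set_at k x : dyadic_set (dyadic_at k x) x.
Proof. exact/dyadic_setP. Qed.

Lemma dyadic_set_children I :
  @dyadic_set R I = dyadic_set (dleft I) `|` dyadic_set (dright I).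
Proof.
apply/seteqP; split => [x /dyadic_set_scaled/andP[h1 h2]|x].
  have [lx|xl] := ltP (2 ^ (I.1 + 1) * x) (2 * I.2 + 1)%:~R; [left|right].
    apply/dyadic_set_scaled; rewrite lx andbT /=.
    move: lx h1 h2; rewrite expfzDr // expr1z !rmorphD /= !rmorphM /=; lra.
  apply/dyadic_set_scaled; rewrite xl /=.
  move: xl h1 h2; rewrite expfzDr // expr1z !rmorphD /= !rmorphM /=; lra.
move=> [] /dyadic_set_scaled/andP[/= h1 h2]; apply/dyadic_set_scaled.
  move: h1 h2; rewrite expfzDr // expr1z !rmorphD /= !rmorphM /=; lra.
move: h1 h2; rewrite expfzDr // expr1z !rmorphD /= !rmorphM /=; lra.
Qed.

Lemma dyadic_set_disjoint I J : I.1 = J.1 -> I <> J ->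
  @dyadic_set R I `&` dyadic_set J = set0.
Proof.
move=> IJ1 IJ; rewrite -subset0 => x [/dyadic_setP hI /dyadic_setP hJ].
by apply: IJ; rewrite -hI -hJ IJ1.
Qed.

Lemma sub_dleft I : @dyadic_set R (dleft I) `<=` dyadic_set I.
Proof. by rewrite (dyadic_set_children I); exact: subsetUl. Qed.

Lemma sub_dright I : @dyadic_set R (dright I) `<=` dyadic_set I.
Proof. by rewrite (dyadic_set_children I); exact: subsetUr. Qed.

Lemma sub_dparent I : @dyadic_set R I `<=` dyadic_set (dparent I).
Proof.
by case: (dchild_parent I) => {1}->; [exact: sub_dleft|exact: sub_dright].
Qed.

Lemma sub_dancestor n I : @dyadic_set R I `<=` dyadic_set (dancestor n I).
Proof.
elim: n => [//|n IH]; apply: subset_trans IH _; exact: sub_dparent.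
Qed.

Lemma measurable_dyadic_set I : measurable (@dyadic_set R I).
Proof.
rewrite (_ : dyadic_set I = `[2 ^ (- I.1) * I.2%:~R, 2 ^ (- I.1) * (I.2 + 1)%:~R[%classic).
  exact: measurable_itv.
by apply/seteqP; split=> x; rewrite /dyadic_set /= in_itv.
Qed.

Lemma dyadic_at_ancestor n k x :
  dancestor n (dyadic_at k x) = dyadic_at (k - n%:Z) x.
Proof.
have /dyadic_setP := @sub_dancestor n _ _ (dyadic_set_at k x).
by rewrite dancestor1.
Qed.

Lemma dyadic_nested I J x : dyadic_set I x -> dyadic_set J x -> I.1 <= J.1 ->
  exists n, dancestor n J = I.
Proof.
move=> /dyadic_setP <- /dyadic_setP <- /= le1; exists `|J.1 - I.1|%N.
by rewrite dyadic_at_ancestor; congr dyadic_at; lia.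
Qed.

End DyadicIntervals.

(** * The dichotomy for the masses of nearby intervals *)

Section Dichotomy.
Variables (R : realType) (V m W S : dyadic -> R) (c p A : R).
Implicit Types (I J : dyadic).

Hypothesis V_gt0 : forall I, 0 < V I.
Hypothesis V_children : forall I, V I = V (dleft I) + V (dright I).
Hypothesis m_def : forall I, m I = V (dleft I) * V (dright I) / V I.
Hypothesis c_ge1 : 1 <= c.
Hypothesis m_balanced :
  forall I, c^-1 * m (dparent I) <= m I <= c * m (dparent I).
Hypothesis p_gt0 : 0 < p.
Hypothesis A_ge0 : 0 <= A.
Hypothesis W_gt0 : forall I, 0 < W I.
Hypothesis S_gt0 : forall I, 0 < S I.
Hypothesis W_parent : forall I, W I <= W (dparent I).
Hypothesis S_parent : forall I, S I <= S (dparent I).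
(** Hoelder's inequality (for p = 1, the bound of 1/w by its norm); then A_p^b on the diagonal, and
    A_p^b for related pairs with denominators cleared. *)
Hypothesis V_le_WS : forall I, V I `^ p <= W I * S I.
Hypothesis WS_le_V : forall I, W I * S I <= A * V I `^ p.
Hypothesis WS_le_V_related : forall I J, b_related I J ->
  W I * S J * (m I `^ (p / 2) * m J `^ (p / 2)) <= A * (V I * V J) `^ p.

Lemma V_sibling I : V (dparent I) = V I + V (dsibling I).
Proof.
case: (dchild_parent I) => ->; rewrite ?dparent_left ?dparent_right V_children.
  by rewrite dsibling_left.
by rewrite dsibling_right addrC.
Qed.

Lemma m_sibling I : m (dparent I) = V I * V (dsibling I) / V (dparent I).
Proof.
rewrite m_def; case: (dchild_parent I) => ->; rewrite ?dparent_left ?dparent_right.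
  by rewrite dsibling_left.
by rewrite dsibling_right [V (dright _) * _]mulrC.
Qed.

Lemma m_gt0 I : 0 < m I.
Proof. by rewrite m_def divr_gt0 ?mulr_gt0. Qed.

Lemma m_le_child I : m (dparent I) <= V I.
Proof.
rewrite m_sibling ler_pdivrMr // ler_pM2l // V_sibling.
by rewrite lerDr ltW.
Qed.

Lemma m_le_V I : m I <= V I.
Proof.
have := m_le_child (dleft I); rewrite dparent_left => /le_trans; apply.
by rewrite [V I]V_children lerDl ltW.
Qed.

(** If a <= b then a <= 2ab/(a + b), and m of the parent is ab/(a + b) for the masses a, b of the
    siblings. This is the substitute for doubling. *)
Lemma V_le_m I : V I <= 2 * m (dparent I) \/ V (dsibling I) <= 2 * m (dparent I).
Proof.
have h (a b : R) : 0 < a -> 0 < b -> a <= b -> a <= 2 * (a * b / (a + b)).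
  move=> a0 b0 ab; rewrite mulrA ler_pdivlMr ?addr_gt0 //.
  have : a * a <= a * b by rewrite ler_pM2l.
  by move=> ?; lra.
rewrite m_sibling V_sibling.
have [le|/ltW le] := leP (V I) (V (dsibling I)); [left|right].
  exact: h.
by rewrite mulrC [V I * _]mulrC [V I + _]addrC [_ * 2]mulrC; apply: h.
Qed.

Lemma c_gt0 : 0 < c. Proof. exact: lt_le_trans c_ge1. Qed.

Lemma m_parent_le I : m (dparent I) <= c * m I.
Proof.
by have /andP[+ _] := m_balanced I; rewrite ler_pdivrMl ?c_gt0.
Qed.

Lemma m_le_parent I : m I <= c * m (dparent I).
Proof. by have /andP[] := m_balanced I. Qed.

Lemma m_dancestor_le n I : m (dancestor n I) <= c ^+ n * m I.
Proof.
elim: n I => [|n IH] I; first by rewrite expr0 mul1r.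
rewrite dancestorS (le_trans (IH _)) // exprSr -mulrA ler_pM2l ?exprn_gt0 ?c_gt0 //.
exact: m_parent_le.
Qed.

Lemma m_le_dancestor n I : m I <= c ^+ n * m (dancestor n I).
Proof.
elim: n I => [|n IH] I; first by rewrite expr0 mul1r.
rewrite dancestorS (le_trans (m_le_parent _)) // exprS -mulrA.
by rewrite ler_pM2l ?c_gt0.
Qed.

Lemma W_dancestor n I : W I <= W (dancestor n I).
Proof. by elim: n => [//|n IH]; rewrite (le_trans IH) //; exact: W_parent. Qed.

(** The hypotheses give V(I)^p <= D^p M with M = m(I)^(p/2) m(J)^(p/2). Inserting this and V(J)^p <=
    W(J) S(J) in the bound for the pair leaves the common factor S(J) M, which cancels. *)
Lemma W_le_of_related D I J : 0 <= D -> b_related I J ->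
  V I <= D * m I -> V I <= D * m J -> W I <= A * D `^ p * W J.
Proof.
move=> D0 IJ VI VJ.
set M := m I `^ (p / 2) * m J `^ (p / 2).
have M0 : 0 < M by rewrite mulr_gt0 // powR_gt0 // m_gt0.
have VM : V I `^ p <= D `^ p * M.
  have h (q : R) : 0 <= q -> q `^ p = q `^ (p / 2) * q `^ (p / 2).
    by move=> q0; rewrite {1}(splitr p) powRD // -splitr (gt_eqF p_gt0).
  have m0 K : 0 <= m K by exact/ltW/m_gt0.
  have g K : V I <= D * m K -> V I `^ (p / 2) <= D `^ (p / 2) * m K `^ (p / 2).
    move=> VK; rewrite -powRM // ge0_ler_powR ?nnegrE ?divr_ge0 ?mulr_ge0 //.
      exact: ltW.
    exact: ltW.
  rewrite h ?(ltW (V_gt0 _)) // [D `^ p]h // /M mulrACA.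
  by rewrite ler_pM ?powR_ge0 // g.
have SM : 0 < S J * M by rewrite mulr_gt0.
rewrite -(ler_pM2r SM) mulrA (le_trans (WS_le_V_related IJ)) //.
rewrite powRM ?(ltW (V_gt0 _)) //.
rewrite (@le_trans _ _ (A * (D `^ p * M * (W J * S J)))) //.
  by rewrite ler_wpM2l // ler_pM ?powR_ge0.
by rewrite le_eqVlt; apply/orP; left; apply/eqP; ring.
Qed.

(** The usual doubling property of A_p weights, for an interval that carries a fixed part of the
    mass of its parent. *)
Lemma W_parent_le D I : 0 <= D -> V (dparent I) <= D * V I ->
  W (dparent I) <= A * D `^ p * W I.
Proof.
move=> D0 VI; rewrite -(ler_pM2r (S_gt0 I)).
rewrite (@le_trans _ _ (W (dparent I) * S (dparent I))) //.
  by rewrite ler_pM2l.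
rewrite (le_trans (WS_le_V _)) // -!mulrA ler_wpM2l //.
rewrite (@le_trans _ _ (D `^ p * V I `^ p)) //; last by rewrite ler_wpM2l ?powR_ge0.
have V0 := ltW (V_gt0 I).
by rewrite -powRM // ge0_ler_powR ?nnegrE ?(ltW p_gt0) ?mulr_ge0 // ltW.
Qed.

Lemma related_sibling_child I J : dparent I = dsibling J -> b_related J I.
Proof.
by move=> IJ; left; rewrite -IJ; case: (dchild_parent I) => IE;
  [constructor 2|constructor 3].
Qed.

Lemma b_related_sym I J : b_related I J -> b_related J I.
Proof.
move=> [[->|->|->]|[->|->]]; first by left; constructor 1.
- by right; left.
- by right; right.
- by left; constructor 2.
- by left; constructor 3.
Qed.

(* The induction step moves one of the intervals to its parent or, when the
   parent is much larger, to the sibling of the parent: the masses then force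
   the pair to satisfy the hypotheses of [W_le_of_related]. *)
Lemma mass_dichotomy s t : exists C, 0 < C /\ forall I J,
  dancestor s I = dancestor t J ->
  m (dancestor s I) * V (dancestor s I) <= C * (V I * V J) \/ W J <= C * W I.
Proof.
have cpos := c_gt0.
(* The factor 2 comes from [V_le_m], and c^2 from comparing m across two generations. *)
pose D := 2 * c ^+ 2.
have D0 : 0 < D by rewrite mulr_gt0 ?exprn_gt0.
have mpar2 I : 2 * m (dparent (dparent I)) <= D * m I.
  by rewrite /D -mulrA ler_pM2l //; exact: (m_dancestor_le 2).
have msib2 I : 2 * m (dparent I) <= D * m I.
  rewrite /D -mulrA ler_pM2l // expr2 -mulrA (le_trans (m_parent_le I)) //.
  by rewrite ler_pM2l // ler_peMl // ltW // m_gt0.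
pose Q := 1 + A * D `^ p.
have Q1 : 1 <= Q by rewrite lerDl mulr_ge0 ?powR_ge0.
have Q0 : 0 < Q by rewrite (lt_le_trans _ Q1).
have AQ : A * D `^ p <= Q by rewrite lerDr.
(* For s = 0, J lies in I. The induction has to start at s = 1, because passing to a sibling
   preserves only the proper ancestors. *)
case: s => [|s].
  exists 1; split=> // I J /= IJ; right; rewrite mul1r IJ; exact: W_dancestor.
elim: s t => [|s IHs] t.
- elim: t => [|t [C [C0 IH]]].
    exists 1; split=> // I J /= <-; left.
    by rewrite mul1r ler_pM2r // m_le_child.
  case: t C C0 IH => [|t] C C0 IH.
    exists 1; split=> // I J /= IJ.
    case: (pselect (J = I)) => [->|JI]; first by right; rewrite mul1r.
    have -> : J = dsibling I.
      move: JI; case: (dchild_parent I) => ->; rewrite IJ;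
        case: (dchild_parent J) => -> ; rewrite ?dparent_left ?dparent_right //.
        by rewrite dsibling_left.
      by rewrite dsibling_right.
    by left; rewrite m_sibling mul1r divfK ?gt_eqF.
  exists (C * (D + 3 + Q)); split=> [|I J' IJ']; first by rewrite mulr_gt0 //; lra.
  set J := dparent J'.
  have IJ : dancestor 1 I = dancestor t.+1 J by rewrite IJ' dancestorS.
  have IB : dancestor 1 I = dancestor t.+1 (dsibling J).
    by rewrite IJ !dancestorS dparent_sibling.
  have DC : C * D <= C * (D + 3 + Q) by rewrite ler_pM2l; lra.
  have C3 : C * 3 <= C * (D + 3 + Q) by rewrite ler_pM2l; lra.
  have QC : C * Q <= C * (D + 3 + Q) by rewrite ler_pM2l; lra.
  have CC : C <= C * (D + 3 + Q) by rewrite ler_peMr //; lra.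
  set K := dancestor 1 I in IJ IB *.
  (* Passing from J to a child J' with V(J) <= E V(J') costs the factor E in the first alternative;
     the second one holds by monotonicity of W. *)
  have useJ E : 0 < E -> C * E <= C * (D + 3 + Q) -> V J <= E * V J' ->
      m K * V K <= C * (D + 3 + Q) * (V I * V J') \/ W J' <= C * (D + 3 + Q) * W I.
    move=> E0 EC VJ; case: (IH _ _ IJ) => [h|h]; [left|right].
      apply: (le_trans h); apply: (@le_trans _ _ (C * E * (V I * V J'))).
        by rewrite -mulrA ler_pM2l // mulrCA ler_pM2l.
      by rewrite ler_pM2r ?mulr_gt0.
    apply: (le_trans (W_parent _)); apply: (le_trans h).
    by rewrite ler_pM2r.
  (* If J is light, then V(J) <= 2 m(dparent J) <= D m(J') <= D V(J'). *)
  have [VJ|VB] := V_le_m J.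
    apply: (useJ D) => //; rewrite (le_trans VJ) // (le_trans (mpar2 _)) //.
    by rewrite ler_pM2l // m_le_V.
  (* If the sibling of J' is light, V(J) <= V(J') + 2 m(J) <= 3 V(J'). Otherwise J' and the sibling
     of J are both light, and the induction hypothesis is used at that sibling, to which J' is
     b-related. *)
  have [VJ'|VJ'] := V_le_m J'; last first.
    apply: (useJ 3) => //; rewrite V_sibling.
    have := m_le_child J'; move: VJ'; lra.
  case: (IH _ _ IB) => [h|h]; [left|right].
    apply: (le_trans h); apply: (@le_trans _ _ (C * D * (V I * V J'))).
      rewrite -mulrA ler_pM2l // mulrCA ler_pM2l //.
      rewrite (le_trans VB) // (le_trans (mpar2 _)) //.
      by rewrite ler_pM2l // m_le_V.
    by rewrite ler_pM2r ?mulr_gt0.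
  apply: (@le_trans _ _ (Q * W (dsibling J))).
    apply: (@le_trans _ _ (A * D `^ p * W (dsibling J))); last by rewrite ler_pM2r.
    apply: W_le_of_related; first exact: ltW.
    - by apply/b_related_sym/related_sibling_child; rewrite dsiblingK.
    - by rewrite (le_trans VJ').
    - rewrite (le_trans VJ') // /D -mulrA ler_pM2l //.
      rewrite (le_trans (m_le_parent _)) // expr2 -mulrA ler_pM2l //.
      by rewrite -dparent_sibling m_parent_le.
  apply: (@le_trans _ _ (Q * (C * W I))); first by rewrite ler_pM2l.
  by rewrite mulrA [Q * C]mulrC ler_pM2r.
have [C [C0 IH]] := IHs t.
exists (C * (D + Q)); split=> [|I' J]; first by rewrite mulr_gt0 //; lra.
rewrite dancestorS; set I := dparent I' => IJ.
have BI : dancestor s.+1 (dsibling I) = dancestor s.+1 I.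
  by rewrite !dancestorS dparent_sibling.
have BJ := etrans BI IJ.
have DC : C * D <= C * (D + Q) by rewrite ler_pM2l; lra.
have QC : C * Q <= C * (D + Q) by rewrite ler_pM2l; lra.
(* The same two cases for I. Now W has to be bounded by its value on the smaller I', against
   monotonicity: [W_parent_le] does this when I' is comparable to I, and [W_le_of_related] when the
   sibling of I is used. *)
have [VI|VB] := V_le_m I.
  have VI' : V I <= D * V I'.
    rewrite (le_trans VI) // (le_trans (mpar2 _)) //.
    by rewrite ler_pM2l // m_le_V.
  case: (IH _ _ IJ) => [h|h]; [left|right].
    apply: (le_trans h); apply: (@le_trans _ _ (C * D * (V I' * V J))).
      by rewrite -mulrA ler_pM2l // mulrA ler_pM2r.
    by rewrite ler_pM2r ?mulr_gt0.
  apply: (le_trans h); apply: (@le_trans _ _ (C * Q * W I')).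
    rewrite -mulrA ler_pM2l //.
    apply: (@le_trans _ _ (A * D `^ p * W I')); last by rewrite ler_pM2r.
    by apply: W_parent_le => //; exact: ltW.
  by rewrite ler_pM2r.
have VB' : V (dsibling I) <= D * m I' by rewrite (le_trans VB) // mpar2.
case: (IH _ _ BJ) => [h|h]; [left|right].
  rewrite -BI; apply: (le_trans h); apply: (@le_trans _ _ (C * D * (V I' * V J))).
    rewrite -mulrA ler_pM2l // mulrA ler_pM2r // (le_trans VB') //.
    by rewrite ler_pM2l // m_le_V.
  by rewrite ler_pM2r ?mulr_gt0.
apply: (le_trans h); apply: (@le_trans _ _ (C * Q * W I')).
  rewrite -mulrA ler_pM2l //.
  apply: (@le_trans _ _ (A * D `^ p * W I')); last by rewrite ler_pM2r.
  apply: W_le_of_related => //; first exact: ltW.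
    by apply: related_sibling_child; rewrite dsiblingK.
  by rewrite (le_trans VB) // -(dparent_sibling I) msib2.
by rewrite ler_pM2r.
Qed.

End Dichotomy.

(** * Measures given by a density *)

Section DensityMeasure.
Context d (T : measurableType d) (R : realType).
Variables (mu : {measure set T -> \bar R}) (g : T -> \bar R).
Hypotheses (mg : measurable_fun [set: T] g) (g0 : forall x, (0 <= g x)%E).

(** Measurability and nonnegativity are arguments so that a measure structure can be declared on the
    set function itself. *)
Definition density of measurable_fun [set: T] g & (forall x, (0 <= g x)%E) :=
  fun A : set T => (\int[mu]_(x in A) g x)%E.

Let density0 : density mg g0 set0 = 0%E.
Proof. by rewrite /density integral_set0. Qed.

Let density_ge0 A : (0 <= density mg g0 A)%E.
Proof. exact: integral_ge0. Qed.

Let density_sigma_additive : semi_sigma_additive (density mg g0).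
Proof. exact: semi_sigma_additive_nng_induced. Qed.

HB.instance Definition _ := isMeasure.Build _ _ _ (density mg g0)
  density0 density_ge0 density_sigma_additive.

End DensityMeasure.

Lemma bigcup_countType_measurable d (T : sigmaRingType d) (U : countType)
    (E : set U) (F : U -> set T) :
  (forall i, measurable (F i)) -> measurable (\bigcup_(i in E) F i).
Proof.
move=> mF; rewrite bigcup_mkcond; apply: countable_bigcupT_measurable => // i.
by case: ifP.
Qed.

(** * A covering principle for families of dyadic intervals *)

Section Covering.
Variable R : realType.
Implicit Types (I J : dyadic).

Definition dyadic_le I J : Prop := exists n, dancestor n I = J.

Lemma dyadic_le_sub I J : dyadic_le I J -> @dyadic_set R I `<=` dyadic_set J.
Proof. by case=> n <-; exact: sub_dancestor. Qed.

(** When I is added, either a selected interval contains it, or it replaces the selected intervals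
    that it contains; nestedness makes it disjoint from the others. *)
Lemma disjoint_subcover (l : seq dyadic) : exists l' : seq dyadic,
  [/\ {subset l' <= l}, trivIset [set` l'] (@dyadic_set R) &
      forall I, I \in l -> exists2 J, J \in l' & dyadic_le I J].
Proof.
elim: l => [|I l [l' [sl tl cl]]].
  exists [::]; split => //; exact: trivIset_set0.
case: (pselect (exists2 J, J \in l' & dyadic_le I J)).
  move=> h; exists l'; split => //.
    by move=> J /sl Jl; rewrite inE Jl orbT.
  by move=> J; rewrite inE => /predU1P[->//|/cl].
move=> nI; exists (I :: [seq J <- l' | ~~ `[< dyadic_le J I >]]).
have tI J : J \in l' -> ~ dyadic_le J I ->
    @dyadic_set R I `&` dyadic_set J = set0.
  move=> Jl' JI; apply: contrapT => /eqP/set0P[x [Ix Jx]].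
  have [le|/ltW le] := leP I.1 J.1.
    by apply: JI; have [n IE] := dyadic_nested Ix Jx le; exists n.
  by apply: nI; have [n IE] := dyadic_nested Jx Ix le; exists J => //; exists n.
split.
- move=> J; rewrite !inE mem_filter => /orP[->//|/andP[_ /sl ->]].
  by rewrite orbT.
- apply/trivIsetP => J K /=.
  rewrite !inE !mem_filter => /predU1P[->|/andP[/asboolPn hJ lJ]];
    move=> /predU1P[->|/andP[/asboolPn hK lK]]; rewrite ?eqxx //.
  + by move=> _; exact: tI.
  + by move=> _; rewrite setIC; exact: tI.
  + by move=> JK; move/trivIsetP: tl; apply.
- move=> J; rewrite inE => /predU1P[->|/cl[K Kl' [n JK]]].
    by exists I; [rewrite inE eqxx|exists 0%N].
  have [[k KI]|KI] := pselect (dyadic_le K I).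
    exists I; first by rewrite inE eqxx.
    by exists (k + n)%N; rewrite dancestorD JK.
  exists K; last by exists n.
  by rewrite inE mem_filter Kl' andbT; apply/orP; right; exact/asboolPn.
Qed.

Section Measures.
Variables (nu tau : {measure set (measurableTypeR R) -> \bar R}).
Variables (E : set dyadic) (B : dyadic -> set (measurableTypeR R)) (c : R).
Hypotheses (c0 : 0 <= c) (mB : forall I, measurable (B I)).
(** This lets the enlargement of a maximal interval cover those of the intervals inside it. *)
Hypothesis B_mono : forall I J, E I -> E J ->
  dyadic_le I J -> B I `<=` B J.
Hypothesis nu_B : forall I, E I -> (nu (B I) <= c%:E * tau (@dyadic_set R I))%E.

Let measurable_cover : measurable (\bigcup_(I in E) @dyadic_set R I).
Proof. by apply: bigcup_countType_measurable => I; exact: measurable_dyadic_set. Qed.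

Lemma covering_finite (l : seq dyadic) : (forall I, I \in l -> E I) ->
  (nu (\bigcup_(I in [set` l]) B I) <= c%:E * tau (\bigcup_(I in E) @dyadic_set R I))%E.
Proof.
move=> lE; have [l' [sl tl cl]] := disjoint_subcover l.
have fl (s : seq dyadic) : finite_set [set` s] by exact: finite_seq.
have mD I : measurable (@dyadic_set R I) by exact: measurable_dyadic_set.
apply: (@le_trans _ _ (\sum_(I \in [set` l']) nu (B I))%E).
  apply: content_sub_fsum => //.

  exact: bigcup_countType_measurable.
  move=> x [I /= Il BIx]; have [J Jl' IJ] := cl _ Il.
  exists J => //; apply: B_mono BIx => //; first exact: lE.
  exact/lE/sl.
apply: (@le_trans _ _ (\sum_(I \in [set` l']) c%:E * tau (@dyadic_set R I))%E).
  by apply: lee_fsum => // I Il'; apply: nu_B; exact/lE/sl.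
rewrite -ge0_mule_fsumr // -measure_fin_bigcup // lee_wpmul2l ?lee_fin //.
apply: le_measure; rewrite ?inE //; first exact: bigcup_countType_measurable.
by move=> x [I /= Il' Ix]; exists I => //; exact/lE/sl.
Qed.

(** E may contain infinite ascending chains and so have no maximal elements. Hence the finite case
    is applied along an enumeration of E, and continuity from below gives the limit. *)
Lemma covering :
  (nu (\bigcup_(I in E) B I) <= c%:E * tau (\bigcup_(I in E) @dyadic_set R I))%E.
Proof.
pose l n := [seq I <- pmap (@pickle_inv dyadic) (iota 0 n) | `[< E I >]].
pose F n := \bigcup_(I in [set` l n]) B I.
have mF n : measurable (F n) by exact: bigcup_countType_measurable.
have ln n I : I \in l n <-> E I /\ (pickle I < n)%N.
  rewrite mem_filter mem_pmap; split=> [/andP[/asboolP EI /mapP[k]]|[EI In]].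
    rewrite mem_iota /= add0n => kn h; split=> //.
    by have := @pickle_invK dyadic k; rewrite -h /= => ->.
  apply/andP; split; first exact/asboolP.
  apply/mapP; exists (pickle I); first by rewrite mem_iota.
  by rewrite pickleK_inv.
have FE : \bigcup_(I in E) B I = \bigcup_n F n.
  apply/seteqP; split=> [x [I EI BI]|x [n _ [I /ln[EI _] BI]]]; last by exists I.
  by exists (pickle I).+1 => //; exists I => //; apply/ln.
have ndF : nondecreasing_seq F.
  move=> n k nk; apply/subsetPset => x [I /ln[EI In] BI]; exists I => //.
  by apply/ln; split=> //; exact: leq_trans nk.
have mUF : measurable (\bigcup_n F n) by exact: bigcupT_measurable.
rewrite FE; apply: (cvge_to_le (nondecreasing_cvg_mu mF mUF ndF)).
near=> n; apply: covering_finite => I /ln[].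
Unshelve. all: by end_near.
Qed.

End Measures.
End Covering.

(** * Suprema over the dyadic intervals containing a point, and the dyadic distance *)

Section DyadicSupremum.
Variable R : realType.
Implicit Types (I J K : dyadic) (a : dyadic -> \bar R) (x : R).
Local Open Scope ereal_scope.

Definition dsup a (x : R) : \bar R :=
  ereal_sup [set a I | I in [set I | @dyadic_set R I x]].

Lemma dsup_ge a I x : @dyadic_set R I x -> a I <= dsup a x.
Proof. by move=> Ix; apply: ereal_sup_ubound; exists I. Qed.

Lemma dsup_le a x y : (forall I, @dyadic_set R I x -> a I <= y) -> dsup a x <= y.
Proof. by move=> h; apply: ge_ereal_sup => _ [I Ix <-]; exact: h. Qed.

Lemma dsup_gtP a x y : y < dsup a x <-> exists2 I, @dyadic_set R I x & y < a I.
Proof.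
split=> [/ereal_sup_gt[_ [I Ix <-] yI]|[I Ix yI]]; first by exists I.
exact/(lt_le_trans yI)/dsup_ge.
Qed.

Lemma dsup_ge0 a x : (forall I, 0 <= a I) -> 0 <= dsup a x.
Proof. by move=> a0; apply: le_trans (a0 _) (dsup_ge _ (dyadic_set_at 0%Z x)). Qed.

Lemma dsup_superlevel a y :
  [set x | y < dsup a x] = \bigcup_(I in [set I | y < a I]) @dyadic_set R I.
Proof.
by apply/seteqP; split=> x /=; rewrite dsup_gtP => -[I]; exists I.
Qed.

Lemma measurable_dsup a :
  measurable_fun [set: measurableTypeR R] (dsup a : measurableTypeR R -> \bar R).
Proof.
apply: (measurability _ (ErealGenOInfty.measurableE R)) => //= _ [_ [r ->]] <-.
apply: measurableI => //; rewrite preimage_itvoy dsup_superlevel.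
by apply: bigcup_countType_measurable => I; exact: measurable_dyadic_set.
Qed.

Lemma ddist_le I J (n : nat) : ddist R I J <= n%:R%:E ->
  exists s t, [/\ (s <= n)%N, (t <= n)%N & dancestor s I = dancestor t J].
Proof.
move=> h; apply: contrapT => nex.
have : n.+1%:R%:E <= ddist R I J.
  apply: le_ereal_inf_tmp => _ [s [t [st ->]]]; rewrite lee_fin ler_nat.
  rewrite ltnNge; apply/negP => stn; apply: nex; exists s, t; split=> //.
    exact: leq_trans (leq_addr _ _) stn.
  exact: leq_trans (leq_addl _ _) stn.
by move=> /le_trans/(_ h); rewrite lee_fin ler_nat ltnn.
Qed.

Lemma ddist_refl I (n : nat) : ddist R I I <= n%:R%:E.
Proof.
apply: ereal_inf_le; exists 0%R%:E; last by rewrite lee_fin ler0n.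
by exists 0%N, 0%N.
Qed.

(** The common ancestor is one generation above one interval and two above the other. The bound 3 is
    what N >= 1 provides for N + 2. *)
Lemma ddist_related I J (n : nat) : (3 <= n)%N -> b_related I J ->
  ddist R I J <= n%:R%:E.
Proof.
have h3 K L : (3 <= n)%N -> dancestor 1 K = dancestor 2 L ->
    ddist R K L <= n%:R%:E /\ ddist R L K <= n%:R%:E.
  move=> n3 KL; split; apply: ereal_inf_le; exists 3%:R%:E;
    rewrite ?lee_fin ?ler_nat //; [exists 1%N, 2%N|exists 2%N, 1%N] => //.
move=> n3 [[->|->|->]|[->|->]]; first exact: ddist_refl.
- by apply: (h3 _ _ n3 _).1; rewrite /= dparent_left dparent_sibling.
- by apply: (h3 _ _ n3 _).1; rewrite /= dparent_right dparent_sibling.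
- by apply: (h3 _ _ n3 _).2; rewrite /= dparent_left dparent_sibling.
- by apply: (h3 _ _ n3 _).2; rewrite /= dparent_right dparent_sibling.
Qed.

End DyadicSupremum.

(** * Bounded enlargements of dyadic intervals *)

Section Halo.
Variables (R : realType) (nu : {measure set (measurableTypeR R) -> \bar R}).
Variables (n : nat) (C : R).
Hypothesis C0 : 0 <= C.
Implicit Types (I J K : dyadic).

Definition near_dyadic I J : Prop :=
  exists s t, [/\ (s <= n)%N, (t <= n)%N & dancestor s I = dancestor t J].

Fixpoint descendants k I : seq dyadic :=
  if k is k'.+1 then I :: descendants k' (dleft I) ++ descendants k' (dright I)
  else [:: I].

Lemma mem_descendants k t I J : (t <= k)%N -> I = dancestor t J -> J \in descendants k I.
Proof.
elim: k t I => [|k IH] t I; first by rewrite leqn0 => /eqP -> ->; rewrite inE.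
case: t => [_ ->|t tk IE]; first by rewrite inE eqxx.
rewrite inE mem_cat; apply/orP; right.
have IE' : I = dparent (dancestor t J) by [].
have [E|E] := dchild_parent (dancestor t J); apply/orP; [left|right].
  by apply: (IH t) => //; rewrite IE' -E.
by apply: (IH t) => //; rewrite IE' -E.
Qed.

(** J is reached from I by at most n steps up and at most n steps down, so the count depends on n
    only. *)
Lemma near_dyadic_finite : exists m : nat, forall I, exists l : seq dyadic,
  (size l <= m)%N /\ forall J, near_dyadic I J -> J \in l.
Proof.
have hk k : exists m, forall I, (size (descendants k I) <= m)%N.
  elim: k => [|k [m hm]]; first by exists 1%N.
  exists (1 + (m + m))%N => I /=; rewrite size_cat add1n ltnS.
  by rewrite leq_add.
have [m hm] := hk n; exists (n.+1 * m)%N => I.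
exists (flatten [seq descendants n (dancestor s I) | s <- iota 0 n.+1]); split.
  rewrite size_flatten /shape -map_comp sumnE big_map.
  apply: (@leq_trans (\sum_(s <- iota 0 n.+1) m)%N).
    by apply: leq_sum => s _; exact: hm.
  by rewrite big_const_seq count_predT size_iota iter_addn_0 mulnC.
move=> J [s [t [sn tn st]]]; apply/flattenP.
exists (descendants n (dancestor s I)); last exact: mem_descendants st.
by apply/mapP; exists s; rewrite ?mem_iota.
Qed.

(** The measure condition singles out the J in the second alternative of the dichotomy; it keeps the
    measure of the halo comparable to that of I. *)
Definition halo I : set (measurableTypeR R) := @dyadic_set R I `|`
  \bigcup_(J in [set J | near_dyadic I J /\
    (nu (@dyadic_set R J) <= C%:E * nu (@dyadic_set R I))%E]) @dyadic_set R J.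

Let mD I : measurable (@dyadic_set R I). Proof. exact: measurable_dyadic_set. Qed.

Lemma measurable_halo I : measurable (halo I).
Proof. by apply: measurableU => //; exact: bigcup_countType_measurable. Qed.

Lemma sub_halo I J : dyadic_le I J -> halo I `<=` halo J.
Proof.
move=> IJ x [Ix|[K [[s [t [sn tn IK]]] nuK] Kx]].
  by left; apply: dyadic_le_sub IJ _ Ix.
have [q JE] := IJ.
(* If the common ancestor of I and K lies in J, so does K. Otherwise K is near J with q fewer steps
   up, and the bound on its measure only weakens from I to J. *)
have [sq|qs] := leqP s q.
  left; rewrite -JE -(subnK sq) dancestorD IK.
  by apply: sub_dancestor; apply: sub_dancestor Kx.
right; exists K => //; split.
  exists (s - q)%N, t; split=> //; first exact: leq_trans (leq_subr _ _) sn.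
  by rewrite -IK -JE -dancestorD subnK // ltnW.
rewrite (le_trans nuK) // lee_wpmul2l ?lee_fin // le_measure ?inE //.
exact: dyadic_le_sub.
Qed.

Lemma measure_halo_le : exists C', 0 <= C' /\ forall I,
  (nu (halo I) <= C'%:E * nu (@dyadic_set R I))%E.
Proof.
have [m hm] := near_dyadic_finite.
exists (1 + m%:R * C); split=> [|I]; first by rewrite addr_ge0 ?mulr_ge0.
have [l [lm hl]] := hm I; set c := nu (@dyadic_set R I).
rewrite (le_trans (measureU2 _ _ _)) //; first exact: bigcup_countType_measurable.
rewrite EFinD ge0_muleDl ?lee_fin ?mulr_ge0 // mul1e leeD2l //.
set A := [set J | _].
have sub (s : seq dyadic) : (nu (\bigcup_(J in [set` s] `&` A) @dyadic_set R J) <=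
    ((size s)%:R * C)%:E * c)%E.
  elim: s => [|J s IH].
    rewrite (_ : [set` [::]] = set0) ?set0I ?bigcup_set0 ?measure0 /=.
      by rewrite mul0r mul0e.
    by apply/seteqP; split.
  pose B := [set x | A J /\ @dyadic_set R J x].
  have [AJ|AJ] := pselect (A J); last first.
    apply: (le_trans _ (le_trans IH _)).
      apply: le_measure; rewrite ?inE; try exact: bigcup_countType_measurable.
      move=> x [K [/= + AK] Kx]; rewrite inE => /predU1P[KJ|Ks].
        by rewrite KJ in AK.
      by exists K.
    rewrite lee_wpmul2r ?measure_ge0 // lee_fin ler_wpM2r // ler_nat.
    exact: leqnSn.
  apply: (@le_trans _ _ (nu (@dyadic_set R J `|`
      \bigcup_(J in [set` s] `&` A) @dyadic_set R J))).
    apply: le_measure; rewrite ?inE; first exact: bigcup_countType_measurable.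
      by apply: measurableU => //; exact: bigcup_countType_measurable.
    move=> x [K [/= + AK] Kx]; rewrite inE => /predU1P[<-|Ks]; first by left.
    by right; exists K.
  rewrite (le_trans (measureU2 _ _ _)) //; first exact: bigcup_countType_measurable.
  rewrite /= -natr1 addrC mulrDl mul1r EFinD ge0_muleDl ?lee_fin ?mulr_ge0 //.
  by rewrite leeD // AJ.2.
apply: (le_trans _ (le_trans (sub l) _)).
  apply: le_measure; rewrite ?inE; try exact: bigcup_countType_measurable.
  by move=> x [K AK Kx]; exists K => //; split=> //; exact: hl AK.1.
rewrite lee_wpmul2r ?measure_ge0 // lee_fin ler_wpM2r // ler_nat //.
Qed.

Lemma measure_bigcup_halo_le : exists C', 0 <= C' /\ forall E : set dyadic,
  (nu (\bigcup_(I in E) halo I) <=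
   C'%:E * nu (\bigcup_(I in E) @dyadic_set R I))%E.
Proof.
have [C' [C'0 h]] := measure_halo_le; exists C'; split=> // E.
apply: covering => //; first exact: measurable_halo.
by move=> I J _ _; exact: sub_halo.
Qed.

End Halo.

(** * Level sets of M^N against those of the dyadic maximal function *)

Section LevelSets.
Variables (R : realType) (mu : {measure set (measurableTypeR R) -> \bar R}).
Hypothesis mu_nondeg : dyadic_nondegenerate mu.
Implicit Types (I J K : dyadic) (f : R -> R).
Local Notation V := (dmass mu).
Local Notation m := (dm mu).

Lemma dyadic_set_children_disjoint I :
  @dyadic_set R (dleft I) `&` dyadic_set (dright I) = set0.
Proof. by apply: dyadic_set_disjoint => //; exact: dleft_neq_right. Qed.

Lemma dmassE I : mu (@dyadic_set R I) = (V I)%:E.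
Proof.
have /andP[h0 h1] := mu_nondeg I.
by rewrite /dmass fineK // ge0_fin_numE // ltW.
Qed.

Lemma dmass_gt0 I : 0 < V I.
Proof. by rewrite -lte_fin -dmassE; have /andP[] := mu_nondeg I. Qed.

Lemma dmass_children I : V I = V (dleft I) + V (dright I).
Proof.
apply: EFin_inj; rewrite EFinD -!dmassE dyadic_set_children measureU //;
  [exact: measurable_dyadic_set..|exact: dyadic_set_children_disjoint].
Qed.

Lemma dm_gt0 I : 0 < m I.
Proof. by rewrite divr_gt0 ?mulr_gt0 ?dmass_gt0. Qed.

Lemma cb_ge0 p I J : 0 <= cb mu p I J.
Proof.
by rewrite /cb; case: ifP => // _; rewrite divr_ge0 ?mulr_ge0 ?powR_ge0 ?(ltW (dmass_gt0 _)).
Qed.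

Lemma daverage_ge0 f I : (forall x, 0 <= f x) -> (0 <= daverage mu f I)%E.
Proof.
move=> f0; rewrite mule_ge0 ?lee_fin ?invr_ge0 ?(ltW (dmass_gt0 _)) //.
by apply: integral_ge0 => x _; rewrite lee_fin.
Qed.

(* The supremum over I is absorbed into the coefficient of J. *)
Lemma dmaximal_dsup N f : dmaximal mu N f =
  dsup (fun J => ereal_sup [set y | exists I,
    (ddist R I J <= (N + 2)%:R%:E)%E /\
    y = ((cb mu 1 I J)%:E * daverage mu (fun z => `|f z|%R) I)%E]).
Proof.
apply/funext => x; set b := fun J => _.
have b0 J : (0 <= b J)%E.
  apply: le_trans (ereal_sup_ubound _); last first.
    by exists J; split; [exact: ddist_refl|reflexivity].
  by rewrite mule_ge0 ?lee_fin ?cb_ge0 // daverage_ge0.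
apply/le_anti/andP; split.
  apply: ge_ereal_sup => _ [I [J [IJ ->]]]; rewrite indicE.
  have [Jx|Jx] := boolP (x \in _).
    rewrite mule1; move: Jx; rewrite inE => Jx.
    by apply: le_trans (dsup_ge b Jx); apply: ereal_sup_ubound; exists I.
  by rewrite mule0; exact: dsup_ge0.
apply: dsup_le => J Jx; apply: ge_ereal_sup => _ [I [IJ ->]].
apply: ereal_sup_ubound; exists I, J; split=> //.
by rewrite indicE mem_set // mule1.
Qed.

Lemma measurable_dmaximal N f : measurable_fun [set: measurableTypeR R]
  (dmaximal mu N f : measurableTypeR R -> \bar R).
Proof. by rewrite dmaximal_dsup; exact: measurable_dsup. Qed.

Lemma dmaximal_gt N f x (y : \bar R) : (y < dmaximal mu N f x)%E ->
  exists I J, [/\ (ddist R I J <= (N + 2)%:R%:E)%E, @dyadic_set R J x &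
    (y < (cb mu 1 I J)%:E * daverage mu (fun z => `|f z|%R) I)%E].
Proof.
rewrite dmaximal_dsup => /dsup_gtP[J Jx /ereal_sup_gt[_ [I [IJ ->]] yI]].
by exists I, J.
Qed.

Lemma dmaximal_ge N f x I J : (ddist R I J <= (N + 2)%:R%:E)%E ->
  @dyadic_set R J x ->
  ((cb mu 1 I J)%:E * daverage mu (fun z => `|f z|%R) I <= dmaximal mu N f x)%E.
Proof.
move=> IJ Jx; rewrite dmaximal_dsup; apply: le_trans (dsup_ge _ Jx).
by apply: ereal_sup_ubound; exists I.
Qed.

Lemma dmaximal_ge0 N f x : (0 <= dmaximal mu N f x)%E.
Proof.
apply: le_trans (dmaximal_ge _ (ddist_refl _ _ _) (dyadic_set_at 0 x)).
by rewrite mule_ge0 ?lee_fin ?cb_ge0 // daverage_ge0.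
Qed.

Variables (c : R) (nu : {measure set (measurableTypeR R) -> \bar R}).
Variables (S : dyadic -> R) (p A : R).
Hypothesis c_ge1 : 1 <= c.
Hypothesis mu_bal : forall I, c^-1 * m (dparent I) <= m I <= c * m (dparent I).
Local Notation W I := (fine (nu (@dyadic_set R I))).
Hypothesis p_gt0 : 0 < p.
Hypothesis A_ge0 : 0 <= A.
Hypothesis nu_gt0 : forall I, (0 < nu (@dyadic_set R I))%E.
Hypothesis nu_lty : forall I, (nu (@dyadic_set R I) < +oo)%E.
Hypothesis S_gt0 : forall I, 0 < S I.
Hypothesis S_parent : forall I, S I <= S (dparent I).
Hypothesis V_le_WS : forall I, V I `^ p <= W I * S I.
Hypothesis WS_le_V : forall I, W I * S I <= A * V I `^ p.
Hypothesis WS_le_V_related : forall I J, b_related I J ->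
  W I * S J * (m I `^ (p / 2) * m J `^ (p / 2)) <= A * (V I * V J) `^ p.

Let nuE I : nu (@dyadic_set R I) = (W I)%:E.
Proof. by rewrite fineK // ge0_fin_numE. Qed.

Lemma mass_dichotomy_uniform n : exists C, 0 < C /\ forall s t I J,
  (s <= n)%N -> (t <= n)%N -> dancestor s I = dancestor t J ->
  m (dancestor s I) * V (dancestor s I) <= C * (V I * V J) \/ W J <= C * W I.
Proof.
have W0 I : 0 < W I by rewrite -lte_fin -nuE.
have Wpar I : W I <= W (dparent I).
  rewrite -lee_fin -!nuE le_measure ?inE //; try exact: measurable_dyadic_set.
  exact: sub_dparent.
have h s t := mass_dichotomy dmass_gt0 dmass_children (fun=> erefl) c_ge1 mu_bal
  p_gt0 A_ge0 W0 S_gt0 Wpar S_parent V_le_WS WS_le_V WS_le_V_related s t.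
have [C hC] := choice (fun st : 'I_n.+1 * 'I_n.+1 => h st.1 st.2).
have C0 st : 0 < C st by case: (hC st).
exists (\sum_st C st); split.
  by rewrite (bigD1 (ord0, ord0)) //= ltr_wpDr ?sumr_ge0 // => i _; rewrite ltW.
move=> s t I J sn tn IJ.
pose st := (Ordinal (sn : (s < n.+1)%N), Ordinal (tn : (t < n.+1)%N)).
have le : C st <= \sum_st C st.
  by rewrite (bigD1 st) //= lerDl sumr_ge0 // => i _; rewrite ltW.
have [_ /(_ I J IJ)[h1|h1]] := hC st; [left|right]; apply: (le_trans h1).
  by rewrite ler_pM2r // mulr_gt0 ?dmass_gt0.
by rewrite ler_pM2r.
Qed.

Lemma dmaximal_superlevel_le N : exists C, 0 < C /\ forall f (t : R),
  measurable_fun [set: measurableTypeR R] (f : measurableTypeR R -> R) -> 0 < t ->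
  (nu [set x | (C * t)%:E < dmaximal mu N f x] <=
   C%:E * nu [set x | t%:E < dsup (daverage mu (fun z => `|f z|%R)) x])%E.
Proof.
set n := (N + 2)%N.
have [C1 [C10 hC1]] := mass_dichotomy_uniform n.
have [C2 [C20 hC2]] := measure_bigcup_halo_le nu n (ltW C10).
have c0 : 0 < c by rewrite (lt_le_trans ltr01).
pose Q := c ^+ n; have Q1 : 1 <= Q by exact: exprn_ege1.
have Q0 : 0 < Q by rewrite (lt_le_trans ltr01).
(* The terms serve, in this order, the pairs I = J, the alternative W(J) <= C1 W(I), the alternative
   on m(K) V(K), and the measure of the halos. *)
pose C := 1 + Q * Q + Q * C1 + C2.
have QQ : 0 < Q * Q by rewrite mulr_gt0.
have QC : 0 < Q * C1 by rewrite mulr_gt0.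
have C0 : 0 < C by rewrite /C; lra.
exists C; split=> // f t mf t0.
set a := daverage mu _; pose E := [set I | (t%:E < a I)%E].
have a0 I : (0 <= a I)%E by rewrite daverage_ge0.
have mrel s I : (s <= n)%N -> m I <= Q * m (dancestor s I) /\
    m (dancestor s I) <= Q * m I.
  move=> sn; have cs : c ^+ s <= Q by rewrite ler_weXn2l.
  have mm := fun J => ltW (dm_gt0 J).
  split; [apply: (le_trans (m_le_dancestor c_ge1 mu_bal s I))
        |apply: (le_trans (m_dancestor_le c_ge1 mu_bal s I))];
  by rewrite ler_wpM2r.
rewrite (@le_trans _ _ (nu (\bigcup_(I in E) halo nu n C1 I))) //; last first.
  apply: (le_trans (hC2 E)); rewrite dsup_superlevel lee_wpmul2r ?measure_ge0 //.
  rewrite lee_fin /C; lra.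
apply: le_measure; rewrite ?inE.
- rewrite -[X in measurable X]setTI; apply: emeasurable_fun_o_infty => //.
  exact: measurable_dmaximal.
- by apply: bigcup_countType_measurable => I; exact: measurable_halo.
move=> x /= /dmaximal_gt[I [J [/ddist_le[s [u [sn un IJ]]] Jx]]].
have [->|neIJ] := eqVneq I J.
  rewrite /cb eqxx mul1e => ltJ; exists J; last by left.
  apply: le_lt_trans ltJ; rewrite lee_fin ler_peMl ?(ltW t0) //.
  by rewrite /C; lra.
set K := dancestor s I.
have QmK0 : 0 <= Q * m K := mulr_ge0 (ltW Q0) (ltW (dm_gt0 K)).
(* Balancedness bounds both m(I) and m(J) by Q m(K), hence also their geometric mean, which is the
   numerator of the coefficient. *)
have cbK : cb mu 1 I J <= Q * m K / V J.
  rewrite /cb (negbTE neIJ) subrr powRr0 mulr1 ler_pM2r ?invr_gt0 ?dmass_gt0 //.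
  have h : Q * m K = (Q * m K) `^ (1 / 2) * (Q * m K) `^ (1 / 2).
    rewrite -powRD; first by rewrite -splitr powRr1.
    by rewrite -splitr oner_eq0.
  have g L : m L <= Q * m K -> m L `^ (1 / 2) <= (Q * m K) `^ (1 / 2).
    move=> LK; apply: ge0_ler_powR => //; rewrite ?nnegrE; exact/ltW/dm_gt0.
  rewrite h ler_pM ?powR_ge0 // g //; first by have [] := mrel s I sn.
  by rewrite /K IJ; have [] := mrel u J un.
(* In the first case the term is at most Q C1 times the average over K, which contains x. In the
   second the coefficient is at most Q^2, so I is in E and J lies in its halo. *)
have [KC|WC] := hC1 s u I J sn un IJ => ltC.
  exists K; last by left; rewrite /K IJ; exact: sub_dancestor Jx.
  rewrite /E /= -(@lte_pmul2l _ C%:E) ?lte_fin //.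
  apply: (lt_le_trans ltC).
  rewrite /a /daverage !muleA -!EFinM.
  apply: lee_pmul; rewrite ?lee_fin ?mulr_ge0 ?invr_ge0 ?cb_ge0 ?(ltW (dmass_gt0 _)) //.
  - by apply: integral_ge0 => z _; rewrite lee_fin.
  - move: cbK; rewrite ler_pdivlMr ?dmass_gt0 // => cbK.
    rewrite ler_pdivrMr ?dmass_gt0 // mulrAC ler_pdivlMr ?dmass_gt0 //.
    rewrite -(ler_pM2r (dmass_gt0 J)) mulrAC (le_trans (ler_wpM2r _ cbK)) //.
      exact/ltW/dmass_gt0.
    rewrite -mulrA (le_trans (ler_wpM2l (ltW Q0) KC)) // mulrA -[_ * V I * V J]mulrA.
    by rewrite ler_pM2r ?mulr_gt0 ?dmass_gt0 // /C; lra.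
  - apply: ge0_subset_integral => //; try exact: measurable_dyadic_set.
    + apply: measurable_funTS; apply/measurable_EFinP; exact: measurableT_comp.
    + exact: sub_dancestor.
exists I; last first.
  right; exists J => //; split; first by exists s, u.
  by rewrite /= (nuE J) (nuE I) -EFinM lee_fin.
rewrite /E /= -(@lte_pmul2l _ C%:E) ?lte_fin //.
apply: (lt_le_trans ltC); rewrite lee_wpmul2r // lee_fin (le_trans cbK) //.
rewrite ler_pdivrMr ?dmass_gt0 //.
have mKJ : m K <= Q * V J.
  rewrite /K IJ (le_trans (mrel u J un).2) // ler_pM2l //.
  exact: (m_le_V dmass_gt0 dmass_children (fun=> erefl)).
rewrite (le_trans (ler_wpM2l (ltW Q0) mKJ)) // mulrA ler_pM2r ?dmass_gt0 //.
by rewrite /C; lra.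
Qed.

End LevelSets.

(** * Integrals compared through level sets *)

Section LayerCake.
Context d (T : measurableType d) (R : realType).
Variable mu : {measure set T -> \bar R}.
Local Open Scope ereal_scope.

Lemma lee_from_real (x y : \bar R) : 0 <= y ->
  (forall r : R, (0 <= r)%R -> r%:E < x -> r%:E <= y) -> x <= y.
Proof.
move=> y0 h; rewrite leNgt; apply/negP => yx.
case: y y0 h yx => [s| |] // y0 h sx; last by rewrite ltNge leey in sx.
rewrite lee_fin in y0.
case: x sx h => [q| |] // sq h; last first.
  by have := h (s + 1)%R (addr_ge0 y0 ler01) (ltry _); rewrite lee_fin; lra.
rewrite lte_fin in sq; have := h ((s + q) / 2)%R; rewrite lte_fin lee_fin => hh.
have : ((s + q) / 2 <= s)%R by apply: hh; lra.
lra.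
Qed.

(** Fatou's lemma: the pointwise hypothesis says that F is at most the lower limit of the f n. It
    serves for Riemann sums, for running maxima and for truncations. *)
Lemma integral_le_of_lower_limit (F : T -> \bar R) (f : nat -> T -> \bar R) B :
  measurable_fun [set: T] F -> (forall n, measurable_fun [set: T] (f n)) ->
  (forall x, 0 <= F x) -> (forall n x, 0 <= f n x) ->
  (forall x (r : R), (0 <= r)%R -> r%:E < F x ->
     exists n0, forall n, (n0 <= n)%N -> r%:E <= f n x) ->
  (forall n, \int[mu]_x f n x <= B) -> \int[mu]_x F x <= B.
Proof.
move=> mF mf F0 f0 h fB.
have le0 (u : nat -> \bar R) r n0 : (forall n, (n0 <= n)%N -> r <= u n) ->
    r <= limn_einf u.
  move=> hu; rewrite limn_einf_lim; apply: lime_ge; first exact: is_cvg_einfs.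
  near=> n; apply: le_ereal_inf_tmp => _ [k /= nk <-]; apply: hu.
  by apply: leq_trans nk; near: n; exists n0.
have le1 (u : nat -> \bar R) : (forall n, u n <= B) -> limn_einf u <= B.
  move=> hu; rewrite limn_einf_lim; apply: lime_le; first exact: is_cvg_einfs.
  near=> n; apply: le_trans (hu n); apply: ereal_inf_lbound; exists n => //=.
apply: le_trans (le1 _ fB); apply: le_trans (fatou mu _ mf _) => //.
apply: ge0_le_integral => //.
- rewrite /limn_einf; apply: measurableT_comp => //.
  by apply: measurable_fun_limn_esup => n; exact: measurableT_comp.
- move=> x _; apply: lee_from_real.
    by apply: (le0 _ 0 0%N) => n _; exact: f0.
  by move=> r r0 /(h x r r0)[n0 hn]; exact: le0 hn.
Unshelve. all: by end_near.
Qed.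

(* Riemann sums of the layer cake formula. *)
Definition layer_sum (m : nat) (dl : R) (F : T -> \bar R) (x : T) : R :=
  (\sum_(k < m) dl * \1_[set y | ((k.+1%:R * dl)%:E < F y)%E] x)%R.

Lemma layer_sum_le m dl F x : (0 <= dl)%R -> 0 <= F x -> (layer_sum m dl F x)%:E <= F x.
Proof.
move=> dl0 F0; rewrite /layer_sum.
have ub n : (\sum_(k < n) dl * \1_[set y | ((k.+1%:R * dl)%:E < F y)%E] x <= n%:R * dl)%R.
  rewrite [leRHS](_ : _ = \sum_(k < n) dl)%R; last first.
    by rewrite sumr_const card_ord mulr_natl.
  by apply: ler_sum => k _; rewrite ler_piMr // indicE; case: (x \in _).
elim: m => [|m IH]; first by rewrite big_ord0.
rewrite big_ord_recr /= [X in (dl * X)%R]indicE.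
case: (boolP (x \in _)) => [|_]; last by rewrite mulr0 addr0.
rewrite inE /= mulr1 => /ltW; apply: le_trans.
by rewrite lee_fin -[m.+1%:R]natr1 mulrDl mul1r lerD2r ub.
Qed.

(** The levels start at dl and not at 0, because level sets are only compared at positive levels;
    the price is the additive error dl. *)
Lemma le_layer_sum m dl F x (s : R) : (0 < dl)%R -> s%:E <= F x ->
  (s <= m%:R * dl)%R -> (s <= dl + layer_sum m dl F x)%R.
Proof.
move=> dl0 sF; rewrite /layer_sum; elim: m => [|m IH] sm.
  by rewrite big_ord0 addr0 (le_trans sm) // mul0r ltW.
have [sm'|ms] := leP s (m%:R * dl)%R.
  rewrite (le_trans (IH sm')) // big_ord_recr /= lerD2l lerDl mulr_ge0 // ltW //.
rewrite (le_trans sm) // big_ord_recr /= -[X in (X * _ <= _)%R]natr1 mulrDl mul1r [leLHS]addrC lerD2l.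
apply: (@le_trans _ _ (\sum_(k < m) dl)%R).
  by rewrite sumr_const card_ord mulr_natl.
rewrite -[leLHS]addr0 lerD //; last by rewrite mulr_ge0 // ltW.
apply: ler_sum => k _; rewrite indicE mem_set ?mulr1 //=.
apply: lt_le_trans sF; rewrite lte_fin; apply: le_lt_trans ms.
by rewrite ler_pM2r // ler_nat.
Qed.

Lemma measurable_superlevel (F : T -> \bar R) y :
  measurable_fun [set: T] F -> measurable [set x | y < F x].
Proof.
by move=> mF; rewrite -[X in measurable X]setTI; exact: emeasurable_fun_o_infty.
Qed.

Lemma measurable_layer_sum m dl F :
  measurable_fun [set: T] F -> measurable_fun [set: T] (layer_sum m dl F).
Proof.
move=> mF; apply: measurable_sum => k; apply: measurable_funM => //.
exact/measurable_indic/measurable_superlevel.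
Qed.

Variable w : T -> R.
Hypotheses (mw : measurable_fun [set: T] w) (w0 : forall x, (0 <= w x)%R).

Lemma integral_layer_sum m dl F : (0 <= dl)%R -> measurable_fun [set: T] F ->
  \int[mu]_x (layer_sum m dl F x * w x)%:E =
  \sum_(k < m) dl%:E * \int[mu]_(x in [set x | ((k.+1%:R * dl)%:E < F x)%E]) (w x)%:E.
Proof.
move=> dl0 mF; have mEw : measurable_fun [set: T] (EFin \o w) by exact/measurable_EFinP.
have mlev k := measurable_superlevel (k.+1%:R * dl)%:E mF.
transitivity (\int[mu]_x \sum_(k < m) dl%:E *
   ((w x)%:E * (\1_[set y | ((k.+1%:R * dl)%:E < F y)%E] x)%:E)).
  apply: eq_integral => x _; rewrite /layer_sum mulr_suml -sumEFin.
  by apply: eq_bigr => k _; rewrite -!EFinM; congr EFin; ring.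
rewrite ge0_integral_sum //; last 2 first.
- move=> k; apply: emeasurable_funM => //; apply: emeasurable_funM => //.
  exact/measurable_EFinP/measurable_indic.
- by move=> k x _; rewrite !mule_ge0 ?lee_fin.
apply: eq_bigr => k _; rewrite ge0_integralZl //; last 2 first.
- apply: emeasurable_funM => //; exact/measurable_EFinP/measurable_indic.
- by move=> x _; rewrite !mule_ge0 ?lee_fin.
by rewrite [in RHS]integral_mkcond; congr (_ * _); apply: eq_integral => x _;
  rewrite epatch_indic.
Qed.

Lemma integral_le_of_levels (F G : T -> \bar R) (C : R) :
  measurable_fun [set: T] F -> measurable_fun [set: T] G ->
  (forall x, 0 <= F x) -> (forall x, 0 <= G x) -> (0 <= C)%R ->
  (forall t : R, (0 < t)%R -> \int[mu]_(x in [set x | t%:E < F x]) (w x)%:E <=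
     C%:E * \int[mu]_(x in [set x | t%:E < G x]) (w x)%:E) ->
  \int[mu]_x (F x * (w x)%:E) <= C%:E * \int[mu]_x (G x * (w x)%:E).
Proof.
move=> mF mG F0 G0 C0 h.
have mEw : measurable_fun [set: T] (EFin \o w) by exact/measurable_EFinP.
(* The mesh is 1/(n + 1) and there are (n + 1)^2 levels: the mesh tends to 0 while the top level n +
   1 tends to infinity. *)
pose dl n : R := (n.+1%:R^-1)%R; have dl0 n : (0 < dl n)%R by rewrite invr_gt0.
pose m n := (n.+1 * n.+1)%N.
apply: (@integral_le_of_lower_limit _
  (fun n x => (layer_sum (m n) (dl n) F x * w x)%:E)).
- exact: emeasurable_funM.
- move=> n; apply/measurable_EFinP/measurable_funM => //.
  exact: measurable_layer_sum.
- by move=> x; rewrite mule_ge0 ?lee_fin.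
- move=> n x; rewrite lee_fin mulr_ge0 // sumr_ge0 // => k _.
  by rewrite mulr_ge0 // ltW.
- move=> x r r0 rF.
  (* If w x were 0, the product would be 0 even where F x is infinite. *)
  have wx : (0 < w x)%R.
    rewrite lt0r w0 andbT; apply/negP => /eqP wx0.
    by move: rF; rewrite wx0 mule0 lte_fin ltNge r0.
  have [s [rs sF]] : exists s : R, (r / w x < s)%R /\ s%:E <= F x.
    move: (F0 x) rF; case: (F x) => [q| |] // _ rF; last first.
      by exists (r / w x + 1)%R; rewrite ltrDl ltr01 leey.
    by exists q; split=> //; rewrite ltr_pdivrMr.
  have gap : (0 < s - r / w x)%R by rewrite subr_gt0.
  (* Once n passes y, the mesh is at most the gap and the top level is at least s. *)
  pose y : R := ((s - r / w x)^-1 + `|s|)%R.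
  have y0 : (0 <= y)%R by rewrite addr_ge0 // invr_ge0 ltW.
  exists (Num.bound y) => n yn.
  have yn1 : (y <= n.+1%:R)%R.
    rewrite (le_trans (ltW (archi_boundP y0))) // ler_nat.
    exact: leq_trans (leqnSn _).
  have sn : (s <= n.+1%:R)%R.
    rewrite (le_trans _ yn1) // (le_trans (ler_norm _)) // lerDr.
    by rewrite invr_ge0 ltW.
  have dls : (dl n <= s - r / w x)%R.
    rewrite -[leRHS]invrK lef_pV2 ?posrE ?invr_gt0 // (le_trans _ yn1) //.
    by rewrite lerDl.
  have := @le_layer_sum (m n) (dl n) F x s (dl0 n) sF.
  rewrite /m natrM -mulrA divff ?pnatr_eq0 // mulr1 => /(_ sn) h1.
  by rewrite lee_fin -ler_pdivrMr //; lra.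
- move=> n; rewrite integral_layer_sum ?(ltW (dl0 _)) //.
  apply: (@le_trans _ _ (C%:E * \int[mu]_x (layer_sum (m n) (dl n) G x * w x)%:E)).
    rewrite integral_layer_sum ?(ltW (dl0 _)) // ge0_sume_distrr; last first.
      move=> k _; rewrite mule_ge0 ?lee_fin ?(ltW (dl0 _)) //.
      by apply: integral_ge0 => x _; rewrite lee_fin.
    apply: lee_sum => k _; rewrite muleCA lee_wpmul2l ?lee_fin ?(ltW (dl0 _)) //.
    by apply: h; rewrite mulr_gt0.
  rewrite lee_wpmul2l ?lee_fin //; apply: ge0_le_integral => //.
  + move=> x _; rewrite lee_fin mulr_ge0 // sumr_ge0 // => k _.
    by rewrite mulr_ge0 // ltW.
  + apply/measurable_EFinP/measurable_funM => //; exact: measurable_layer_sum.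
  + exact: emeasurable_funM.
  + move=> x _; rewrite EFinM lee_wpmul2r ?lee_fin // layer_sum_le //.
    exact: ltW.
Qed.

End LayerCake.

(** * Young's inequality *)

Section Young.
Variables (R : realType) (q : R).
Hypothesis q_gt1 : 1 < q.
Implicit Types (y a z v : R).

Lemma young_powR y a : 0 <= y -> 0 <= a ->
  q * (y `^ (q - 1) * a) <= (q - 1) * y `^ q + a `^ q.
Proof.
move=> y0 a0; have q0 : 0 < q by rewrite (lt_trans ltr01).
have q1 : 0 < q - 1 by rewrite subr_gt0.
have := @conjugate_powR R (y `^ (q - 1)) a (q / (q - 1)) q (powR_ge0 _ _) a0.
rewrite divr_gt0 // => /(_ isT q0) h.
have {}h : y `^ (q - 1) * a <= y `^ q / (q / (q - 1)) + a `^ q / q.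
  rewrite (_ : y `^ q = (y `^ (q - 1)) `^ (q / (q - 1))); last first.
    by rewrite -powRrM mulrC divfK // gt_eqF.
  by apply: h; field; rewrite !gt_eqF.
rewrite mulrC -ler_pdivlMr // (le_trans h) // le_eqVlt; apply/orP; left.
by apply/eqP; field; rewrite !gt_eqF.
Qed.

(** This is [young_powR] for a = q' z / v, with q' = q / (q - 1), multiplied by v. *)
Lemma young_weighted y z v : 0 <= y -> 0 <= z -> 0 < v ->
  q * (q / (q - 1)) * y `^ (q - 1) * z <=
  (q / (q - 1)) `^ q * (z `^ q * v `^ (1 - q)) + (q - 1) * y `^ q * v.
Proof.
move=> y0 z0 v0; have q0 : 0 < q by rewrite (lt_trans ltr01).
have q1 : 0 < q - 1 by rewrite subr_gt0.
set q' := q / (q - 1); have q'0 : 0 <= q' by rewrite divr_ge0 ?ltW.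
have qz : 0 <= q' * z := mulr_ge0 q'0 z0.
have vi : 0 <= v^-1 by rewrite invr_ge0 ltW.
have := young_powR y0 (mulr_ge0 qz vi).
rewrite -(ler_pM2r v0) => h; apply: le_trans (le_trans h _).
  rewrite le_eqVlt; apply/orP; left; apply/eqP; field; exact: lt0r_neq0.
rewrite mulrDl addrC lerD2r (powRM _ qz vi) (powRM _ q'0 z0).
rewrite -!mulrA ler_wpM2l ?powR_ge0 // ler_wpM2l ?powR_ge0 //.
rewrite -powR_inv1 ?(ltW v0) // -powRrM mulN1r -{2}[v]powRr1 ?(ltW v0) //.
rewrite -powRD; first by rewrite addrC.
by rewrite (lt0r_neq0 v0) implybT.
Qed.

End Young.

Lemma absz_window (k : int) (n : nat) : (absz k < n)%N ->
  - n%:Z + 1 <= k < - n%:Z + 1 + n.*2%:Z.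
Proof. lia. Qed.

(** * Doob's maximal inequality along the dyadic tree *)

Section DyadicDoob.
Variables (R : realType) (mu : {measure set (measurableTypeR R) -> \bar R}).
Variables (v : R -> R) (h H : R -> \bar R) (q : R).
Local Notation q' := (q / (q - 1)).
Local Notation A := (q' `^ q).
Implicit Types (I J : dyadic) (x y : R).
Hypothesis q_gt1 : 1 < q.
Hypothesis mv : measurable_fun [set: measurableTypeR R] (v : measurableTypeR R -> R).
Hypothesis mh : measurable_fun [set: measurableTypeR R] (h : measurableTypeR R -> \bar R).
Hypothesis mH : measurable_fun [set: measurableTypeR R] (H : measurableTypeR R -> \bar R).
Hypothesis v_gt0 : forall x, 0 < v x.
Hypothesis h_ge0 : forall x, (0 <= h x)%E.
Hypothesis H_ge0 : forall x, (0 <= H x)%E.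
(** The model is H = h^q v^(1 - q), by [young_weighted]. Keeping only this consequence allows h and
    H to be infinite at some points, as may happen when h comes from another maximal function. *)
Hypothesis young : forall x y, 0 <= y ->
  ((q * q' * y `^ (q - 1))%:E * h x <= A%:E * H x + ((q - 1) * y `^ q * v x)%:E)%E.
Local Notation iv I := (\int[mu]_(x in @dyadic_set R I) (v x)%:E)%E.
Local Notation ih I := (\int[mu]_(x in @dyadic_set R I) h x)%E.
Local Notation iH I := (\int[mu]_(x in @dyadic_set R I) H x)%E.
Hypothesis v_int : forall I, (0 < iv I < +oo)%E.
Hypothesis H_fin : (\int[mu]_x H x < +oo)%E.

Local Notation vv I := (fine (iv I)).
Local Notation hh I := (fine (ih I)).
Local Notation HH I := (fine (iH I)).

Let q0 : 0 < q. Proof. by rewrite (lt_trans ltr01). Qed.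
Let q1 : 0 < q - 1. Proof. by rewrite subr_gt0. Qed.
Let q'0 : 0 < q'. Proof. by rewrite divr_gt0. Qed.
Let A0 : 0 < A. Proof. by rewrite powR_gt0. Qed.
Let mD I : measurable (@dyadic_set R I). Proof. exact: measurable_dyadic_set. Qed.
Let mEv : measurable_fun [set: measurableTypeR R] (EFin \o v : measurableTypeR R -> \bar R).
Proof. exact/measurable_EFinP. Qed.

Lemma integral_dyadic_children (g : R -> \bar R) I :
  measurable_fun [set: measurableTypeR R] (g : measurableTypeR R -> \bar R) ->
  (forall x, 0 <= g x)%E ->
  (\int[mu]_(x in @dyadic_set R I) g x =
   \int[mu]_(x in @dyadic_set R (dleft I)) g x +
   \int[mu]_(x in @dyadic_set R (dright I)) g x)%E.
Proof.
move=> mg g0; rewrite {1}dyadic_set_children ge0_integral_setU //.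
- exact: measurable_funTS.
- by apply/disj_set2P; exact: dyadic_set_children_disjoint.
Qed.

Let vE I : iv I = (vv I)%:E.
Proof. by have /andP[h1 h2] := v_int I; rewrite fineK // ge0_fin_numE // ltW. Qed.

Let HE I : iH I = (HH I)%:E.
Proof.
rewrite fineK // ge0_fin_numE ?integral_ge0 //; apply: le_lt_trans H_fin.
exact: ge0_subset_integral.
Qed.

Let hY I y : 0 <= y -> ((q * q' * y `^ (q - 1))%:E * ih I <=
  A%:E * iH I + ((q - 1) * y `^ q)%:E * iv I)%E.
Proof.
move=> y0; have c0 : 0 <= q * q' * y `^ (q - 1).
  exact: mulr_ge0 (mulr_ge0 (ltW q0) (ltW q'0)) (powR_ge0 _ _).
have c1 : 0 <= (q - 1) * y `^ q by rewrite mulr_ge0 ?powR_ge0 ?(ltW q1).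
have m1 g : measurable_fun [set: measurableTypeR R] (g : measurableTypeR R -> \bar R) ->
    measurable_fun (@dyadic_set R I) (g : measurableTypeR R -> \bar R).
  exact: measurable_funTS.
rewrite -!ge0_integralZl ?lee_fin ?(ltW A0) //; try (by apply: m1);
  try (by move=> x _; rewrite ?lee_fin ?(ltW (v_gt0 x))).
rewrite -ge0_integralD //; last 4 first.
- by move=> x _; rewrite mule_ge0 ?lee_fin ?(ltW A0).
- by apply: m1; apply: emeasurable_funM.
- by move=> x _; rewrite mule_ge0 ?lee_fin ?(ltW (v_gt0 x)).
- by apply: m1; apply: emeasurable_funM.
apply: ge0_le_integral => //.
- by move=> x _; rewrite mule_ge0 ?lee_fin.
- by apply: m1; apply: emeasurable_funM.
- by apply: m1; apply: emeasurable_funD; apply: emeasurable_funM.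
- by move=> x _; rewrite -EFinM; exact: young.
Qed.

(** At y = 1 the hypothesis [young] bounds h by a combination of H and v, which have finite
    integrals over I. *)
Lemma doob_integrand_fin I : ih I = (hh I)%:E.
Proof.
rewrite fineK // ge0_fin_numE ?integral_ge0 //.
have := hY I ler01; rewrite HE vE -!EFinM -EFinD powR1 mulr1 => le.
have qq' : (0 < (q * q')%:E)%E by rewrite lte_fin (mulr_gt0 q0 q'0).
rewrite -(@lte_pmul2l _ (q * q')%:E) //.
by apply: le_lt_trans le _; rewrite gt0_muley ?ltry.
Qed.

Let hYr I y : 0 <= y -> q * q' * y `^ (q - 1) * hh I <= A * HH I + (q - 1) * y `^ q * vv I.
Proof. by move=> y0; have := hY I y0; rewrite doob_integrand_fin HE vE -!EFinM -EFinD lee_fin. Qed.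

Let v0 I : 0 < vv I.
Proof. by rewrite -lte_fin -vE; have /andP[] := v_int I. Qed.

Let h0 I : 0 <= hh I. Proof. exact/fine_ge0/integral_ge0. Qed.

Definition average_ratio I : R := hh I / vv I.
Local Notation a := average_ratio.

Let a0 I : 0 <= a I. Proof. by rewrite divr_ge0 // ltW. Qed.

(** The value y is an accumulator, so that the induction on n can raise it to the average over the
    current interval at each generation. *)
Fixpoint running_max (n : nat) (k : int) y x : R :=
  if n is n'.+1 then running_max n' (k + 1) (Num.max y (a (dyadic_at k x))) x
  else y.

Lemma running_max_ge n k y x : y <= running_max n k y x.
Proof.
elim: n k y => [//|n IH] k y /=; apply: le_trans (IH _ _).
by rewrite le_max lexx.
Qed.

Lemma le_running_max n k j y x : k <= j < k + n%:Z ->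
  a (dyadic_at j x) <= running_max n k y x.
Proof.
elim: n k y => [|n IH] k y /=; first by lia.
move=> kj; have [->|jk] := eqVneq j k; last by apply: IH; lia.
by apply: le_trans (running_max_ge _ _ _ _); rewrite le_max lexx orbT.
Qed.

Lemma measurable_dyadic_at (b : dyadic -> R) k :
  measurable_fun [set: measurableTypeR R]
    ((fun x => b (dyadic_at k x)) : measurableTypeR R -> R).
Proof.
move=> _ B mB; rewrite setTI.
rewrite (_ : _ @^-1` _ = \bigcup_(I in [set I | I.1 = k /\ B (b I)]) @dyadic_set R I).
  exact: bigcup_countType_measurable.
apply/seteqP; split=> [x /= Bx|x [I [<- BI] /dyadic_setP Ix]]; last by rewrite /= Ix.
by exists (dyadic_at k x) => //; exact: dyadic_set_at.
Qed.

Lemma measurable_running_max n k (Y : R -> R) :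
  measurable_fun [set: measurableTypeR R] (Y : measurableTypeR R -> R) ->
  measurable_fun [set: measurableTypeR R]
    ((fun x => running_max n k (Y x) x) : measurableTypeR R -> R).
Proof.
elim: n k Y => [//|n IH] k Y mY /=; apply: IH.
by apply: measurable_maxr => //; exact: measurable_dyadic_at.
Qed.

Let mpow (Y : R -> R) :
  measurable_fun [set: measurableTypeR R] (Y : measurableTypeR R -> R) ->
  measurable_fun [set: measurableTypeR R]
   ((fun x => (Y x `^ q * v x)%:E) : measurableTypeR R -> \bar R).
Proof.
move=> mY; apply/measurable_EFinP/measurable_funM => //.
by apply: (measurableT_comp (measurable_powR q)).
Qed.

Let pow0 (Y : R -> R) x : (0 <= (Y x `^ q * v x)%:E)%E.
Proof. by rewrite lee_fin mulr_ge0 ?powR_ge0 // ltW. Qed.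

(* The right-hand side is a Bellman function for Doob's inequality: as a function
   of y it does not increase when y is raised to the average over a child of I. *)
Lemma integral_running_max_le n I y : 0 <= y -> a I <= y ->
  (\int[mu]_(x in @dyadic_set R I) (running_max n (I.1 + 1) y x `^ q * v x)%:E <=
   (A * HH I + (q * y `^ q * vv I - q * q' * y `^ (q - 1) * hh I))%:E)%E.
Proof.
elim: n I y => [|n IH] I y y0 ay /=.
  under eq_integral do rewrite EFinM.
  rewrite ge0_integralZl ?lee_fin ?powR_ge0 //; last 2 first.
  - exact: measurable_funTS.
  - by move=> x _; rewrite lee_fin ltW.
  by rewrite vE -EFinM lee_fin; have := hYr I y0; lra.
pose g J z := q * z `^ q * vv J - q * q' * z `^ (q - 1) * hh J.
(* As a function of z, g J z has derivative q^2 z^(q-2) (z - a J) vv J, which is negative below a J.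
   Integrated, this is Young's inequality. *)
have gmax J : g J (Num.max y (a J)) <= g J y.
  have [//|ya] := leP (a J) y.
  rewrite /g; have -> : hh J = a J * vv J by rewrite divfK // gt_eqF.
  have aq : a J `^ (q - 1) * a J = a J `^ q.
    rewrite -{2}[a J]powRr1 // -powRD ?subrK //; apply/implyP => _.
    by rewrite gt_eqF // (le_lt_trans y0).
  have Y : q' * (y `^ (q - 1) * a J) <= y `^ q + (q' - 1) * a J `^ q.
    rewrite mulrAC ler_pdivrMr // (le_trans (young_powR q_gt1 y0 (a0 J))) //.
    rewrite le_eqVlt; apply/orP; left; apply/eqP; field; exact: lt0r_neq0.
  have := ler_wpM2l (ltW (mulr_gt0 q0 (v0 J))) Y.
  rewrite mulrA -[_ * a J `^ (q - 1) * _]mulrA [a J `^ (q - 1) * _]mulrA aq; lra.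
have child J : J.1 = I.1 + 1 ->
    (\int[mu]_(x in @dyadic_set R J)
      (running_max n (I.1 + 1 + 1) (Num.max y (a (dyadic_at (I.1 + 1) x))) x `^ q * v x)%:E
      <= (A * HH J + g J y)%:E)%E.
  move=> J1; have -> : (\int[mu]_(x in @dyadic_set R J)
      (running_max n (I.1 + 1 + 1) (Num.max y (a (dyadic_at (I.1 + 1) x))) x `^ q * v x)%:E
      = \int[mu]_(x in @dyadic_set R J)
      (running_max n (J.1 + 1) (Num.max y (a J)) x `^ q * v x)%:E)%E.
    apply: eq_integral => x; rewrite inE => /dyadic_setP Jx.
    by rewrite -J1 Jx.
  apply: le_trans (IH J _ _ _) _; first by rewrite le_max y0.
    by rewrite le_max lexx orbT.
  by rewrite lee_fin lerD2l gmax.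
rewrite integral_dyadic_children; last 2 first.
- apply: mpow; apply: measurable_running_max; apply: measurable_maxr => //.
  exact: measurable_dyadic_at.
- by move=> x; exact: pow0.
have hI : hh I = hh (dleft I) + hh (dright I).
  by apply: EFin_inj; rewrite EFinD -!doob_integrand_fin; exact: integral_dyadic_children.
have vI : vv I = vv (dleft I) + vv (dright I).
  apply: EFin_inj; rewrite EFinD -!vE; apply: integral_dyadic_children => // x.
  by rewrite lee_fin ltW.
have HI : HH I = HH (dleft I) + HH (dright I).
  by apply: EFin_inj; rewrite EFinD -!HE; exact: integral_dyadic_children.
apply: (le_trans (leeD (child (dleft I) erefl) (child (dright I) erefl))).
by rewrite -EFinD lee_fin hI vI HI /g; lra.
Qed.

Lemma integral_running_max_line_le (n : nat) :
  (\int[mu]_x (running_max n.*2 (- n%:Z + 1) (a (dyadic_at (- n%:Z) x)) x `^ q * v x)%:E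
   <= A%:E * \int[mu]_x H x)%E.
Proof.
pose Y := fun x : R => running_max n.*2 (- n%:Z + 1) (a (dyadic_at (- n%:Z) x)) x.
have mY : measurable_fun [set: measurableTypeR R] (Y : measurableTypeR R -> R).
  by apply: measurable_running_max; exact: measurable_dyadic_at.
have F0 x : (0 <= (Y x `^ q * v x)%:E)%E by exact: pow0.
(* The intervals of generation -n partition the line; [covering], applied with B I = I, sums the
   estimates over them. *)
pose E := [set I : dyadic | I.1 = - n%:Z].
have coverT : \bigcup_(I in E) @dyadic_set R I = [set: measurableTypeR R].
  by apply/seteqP; split=> // x _; exists (dyadic_at (- n%:Z) x) => //; exact: dyadic_set_at.
have := @covering R (density mu (mpow mY) F0) (density mu mH H_ge0) E
  (@dyadic_set R) A (ltW A0) mD.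
rewrite coverT; apply => [I J _ _|I E_I]; first exact: dyadic_le_sub.
suff : (\int[mu]_(x in @dyadic_set R I) (Y x `^ q * v x)%:E <= (A * HH I)%:E)%E.
  by rewrite EFinM -HE.
have -> : (\int[mu]_(x in @dyadic_set R I) (Y x `^ q * v x)%:E =
    \int[mu]_(x in @dyadic_set R I)
      (running_max n.*2 (I.1 + 1) (a I) x `^ q * v x)%:E)%E.
  apply: eq_integral => x; rewrite inE => /dyadic_setP Ix.
  by rewrite /Y -E_I Ix.
apply: (le_trans (integral_running_max_le _ (a0 I) (lexx _))).
(* For y = a I the term added to A * HH I equals q (1 - q') (a I)^q vv I, which is not positive. *)
rewrite lee_fin gerDl.
have aq : a I `^ (q - 1) * hh I = a I `^ q * vv I.
  have -> : hh I = a I * vv I by rewrite divfK // gt_eqF.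
  have [->|aN0] := eqVneq (a I) 0; first by rewrite mul0r mulr0 powR0 ?mul0r ?gt_eqF.
  rewrite mulrA -{2}[a I]powRr1 // -powRD ?subrK //; apply/implyP => _.
  exact: aN0.
rewrite -[_ * hh I]mulrA aq.
have Z0 : 0 <= a I `^ q * vv I by rewrite mulr_ge0 ?powR_ge0 // ltW.
have q'1 : 1 <= q' by rewrite ler_pdivlMr // mul1r; lra.
have := ler_wpM2l (mulr_ge0 (ltW q0) Z0) q'1; lra.
Qed.

(** At stage n the running maximum covers the generations from -n to n, so every average over an
    interval containing x is eventually included. *)
Lemma doob : (\int[mu]_x (dsup (fun I => (a I)%:E) x `^ q * (v x)%:E)
  <= A%:E * \int[mu]_x H x)%E.
Proof.
have sup0 x : (0 <= dsup (fun I => (a I)%:E) x)%E by apply: dsup_ge0 => I; rewrite lee_fin.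
apply: (@integral_le_of_lower_limit _ (measurableTypeR R) R mu _ (fun n x =>
  (running_max n.*2 (- n%:Z + 1) (a (dyadic_at (- n%:Z) x)) x `^ q * v x)%:E)).
- apply: emeasurable_funM => //.
  by apply: (measurableT_comp (measurable_poweR q)); exact: measurable_dsup.
- move=> n; apply: mpow; apply: measurable_running_max; exact: measurable_dyadic_at.
- by move=> x; rewrite mule_ge0 ?poweR_ge0 // lee_fin ltW.
- by move=> n x; exact: pow0.
- move=> x r r0 rx.
  pose s := (r / v x) `^ q^-1.
  have rv0 : 0 <= r / v x by rewrite divr_ge0 // ltW.
  have sq : s `^ q = r / v x.
    by rewrite /s -powRrM mulVf ?gt_eqF // powRr1.
  have : (s%:E < dsup (fun I => (a I)%:E) x)%E.
    rewrite ltNge; apply/negP => le.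
    have := @gt0_ler_poweR R q (ltW q0) _ _ _ _ le.
    rewrite !in_itv /= !leey !sup0 lee_fin powR_ge0 => /(_ isT isT).
    rewrite sq => le'.
    have := @lee_wpmul2r _ (v x)%:E; rewrite lee_fin => /(_ (ltW (v_gt0 x)) _ _ le').
    by rewrite -EFinM divfK ?gt_eqF // leNgt rx.
  move=> /dsup_gtP[I /dyadic_setP Ix sI]; rewrite lte_fin in sI.
  exists (absz I.1).+1 => n nI.
  rewrite lee_fin -ler_pdivrMr // -sq ge0_ler_powR ?nnegrE ?powR_ge0 ?(ltW q0) //.
    by apply: le_trans (a0 _) (running_max_ge _ _ _ _).
  apply: (le_trans (ltW sI)); rewrite -Ix; apply: le_running_max.
  exact: absz_window.
- exact: integral_running_max_line_le.
Qed.

End DyadicDoob.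

Section PowerLemmas.
Variable R : realType.
Implicit Types (x : \bar R) (p t : R).

Lemma lt_poweR_real p t x : 0 < p -> 0 <= t -> (0 <= x)%E ->
  (t%:E < x `^ p)%E = ((t `^ p^-1)%:E < x)%E.
Proof.
move=> p0 t0; case: x => [r| |] //.
  rewrite lee_fin => r0; rewrite poweR_EFin !lte_fin !ltNge; congr (~~ _).
  apply/idP/idP => h.
    rewrite -[r]powRr1 // -(mulfV (lt0r_neq0 p0)) powRrM.
    by apply: ge0_ler_powR; rewrite ?nnegrE ?invr_ge0 ?powR_ge0 ?(ltW p0).
  rewrite -[t]powRr1 // -(mulVf (lt0r_neq0 p0)) powRrM.
  by apply: ge0_ler_powR; rewrite ?nnegrE ?powR_ge0 ?(ltW p0).
by move=> _; rewrite poweRyr ?gt_eqF // !ltry.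
Qed.

Lemma ge0_le_poweR p x y : 0 <= p -> (0 <= x)%E -> (x <= y)%E -> (x `^ p <= y `^ p)%E.
Proof.
move=> p0 x0 xy; apply: gt0_ler_poweR => //.
  by rewrite in_itv /= x0 leey.
by rewrite in_itv /= (le_trans x0 xy) leey.
Qed.

End PowerLemmas.

(** * The strong bound for the dyadic maximal function *)

Section DyadicMuckenhoupt.
Variables (R : realType) (mu : {measure set (measurableTypeR R) -> \bar R}).
Variables (w : R -> R) (p A : R).
Hypothesis mu_nondeg : dyadic_nondegenerate mu.
Hypothesis p_gt1 : 1 < p.
Hypothesis A_ge0 : 0 <= A.
Hypothesis mw : measurable_fun [set: measurableTypeR R] (w : measurableTypeR R -> R).
Hypothesis w_gt0 : forall x, 0 < w x.
Local Notation p' := (p / (p - 1)).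
Local Notation sigma := (fun x => w x `^ (1 - p')).
Local Notation iw I := (\int[mu]_(x in @dyadic_set R I) (w x)%:E)%E.
Local Notation isg I := (\int[mu]_(x in @dyadic_set R I) (sigma x)%:E)%E.
Hypothesis w_int : forall I, (0 < iw I < +oo)%E.
Hypothesis sigma_int : forall I, (0 < isg I < +oo)%E.
Hypothesis dyadic_Ap : forall I,
  fine (iw I) * fine (isg I) `^ (p - 1) <= A * dmass mu I `^ p.

Let p0 : 0 < p. Proof. by rewrite (lt_trans ltr01). Qed.
Let p1 : 0 < p - 1. Proof. by rewrite subr_gt0. Qed.
Let p'1 : 1 < p'. Proof. by rewrite ltr_pdivlMr // mul1r; lra. Qed.
Let p'0 : 0 < p'. Proof. by rewrite divr_gt0. Qed.
Let p'_1 : p' - 1 = (p - 1)^-1. Proof. by field; rewrite gt_eqF. Qed.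
Let p'' : p' / (p' - 1) = p. Proof. by rewrite p'_1 invrK divfK // gt_eqF. Qed.
Let sigma_gt0 x : 0 < sigma x. Proof. exact: powR_gt0. Qed.
Let msigma : measurable_fun [set: measurableTypeR R] (sigma : measurableTypeR R -> R).
Proof. exact: (measurableT_comp (measurable_powR _)). Qed.

Let sigma_pow x : sigma x `^ (1 - p) = w x.
Proof.
rewrite -powRrM (_ : _ * _ = 1); first by rewrite powRr1 // ltW.
by field; exact: lt0r_neq0.
Qed.

(* The maximal operator is dominated by the composition of the maximal
   operators of the measures sigma mu and w mu, as in Lerner's proof of
   Buckley's theorem. *)
Lemma dyadic_muckenhoupt : exists K, 0 <= K /\ forall f : R -> R,
  measurable_fun [set: measurableTypeR R] (f : measurableTypeR R -> R) ->
  (\int[mu]_x ((`|f x| `^ p)%R * w x)%:E < +oo)%E ->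
  (\int[mu]_x (dsup (daverage mu (fun z => `|f z|%R)) x `^ p * (w x)%:E) <=
   K%:E * \int[mu]_x ((`|f x| `^ p)%R * w x)%:E)%E.
Proof.
(* A^p' comes from the pointwise estimate; p^p' and p'^p are the constants in Doob's inequality for
   the exponents p' and p. *)
exists (A `^ p' * (p `^ p' * p' `^ p)); split=> [|f mf ffin].
  by rewrite !mulr_ge0 ?powR_ge0.
have mabs : measurable_fun [set: measurableTypeR R]
    ((fun x => `|f x|%:E) : measurableTypeR R -> \bar R).
  by apply/measurable_EFinP; exact: measurableT_comp.
have mfp : measurable_fun [set: measurableTypeR R]
    ((fun x => (`|f x| `^ p * w x)%:E) : measurableTypeR R -> \bar R).
  apply/measurable_EFinP/measurable_funM => //.
  by apply: (measurableT_comp (measurable_powR _)); exact: measurableT_comp.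
pose h x := `|f x|%:E; pose H x := (`|f x| `^ p * w x)%:E.
have h0 x : (0 <= h x)%E by rewrite lee_fin.
have H0 x : (0 <= H x)%E by rewrite lee_fin mulr_ge0 ?powR_ge0 // ltW.
have yng x y : 0 <= y -> ((p * p' * y `^ (p - 1))%:E * h x <=
    (p' `^ p)%:E * H x + ((p - 1) * y `^ p * sigma x)%:E)%E.
  move=> y0; rewrite -!EFinM -EFinD lee_fin -{1}(sigma_pow x).
  exact: young_weighted.
have doob1 := doob p_gt1 msigma mabs mfp sigma_gt0 h0 H0 yng sigma_int ffin.
have hfin := doob_integrand_fin p_gt1 msigma mabs mfp sigma_gt0 h0 H0 yng sigma_int ffin.
set a1 := average_ratio mu sigma h in doob1.
pose G := dsup (fun I => (a1 I)%:E).
have a10 I : 0 <= a1 I.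
  by rewrite divr_ge0 // fine_ge0 ?integral_ge0 // => x _; rewrite ?lee_fin ?ltW.
have G0 x : (0 <= G x)%E by apply: dsup_ge0 => I; rewrite lee_fin.
have mG : measurable_fun [set: measurableTypeR R] (G : measurableTypeR R -> \bar R).
  exact: measurable_dsup.
have mGp r : measurable_fun [set: measurableTypeR R]
    ((fun x => (G x `^ r)%E) : measurableTypeR R -> \bar R).
  exact: (measurableT_comp (measurable_poweR r)).
(* Since (p - 1) p' = p and sigma = w^(1 - p'), H2 is h2^p' w^(1 - p'). Its integral is the
   left-hand side of the first Doob inequality, so the two chain. *)
pose h2 x := (G x `^ (p - 1))%E; pose H2 x := (G x `^ p * (sigma x)%:E)%E.
have mH2 : measurable_fun [set: measurableTypeR R] (H2 : measurableTypeR R -> \bar R).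
  by apply: emeasurable_funM => //; exact/measurable_EFinP.
have h20 x : (0 <= h2 x)%E by exact: poweR_ge0.
have H20 x : (0 <= H2 x)%E by rewrite mule_ge0 ?poweR_ge0 // lee_fin ltW.
have p1p' : (p - 1) * p' = p by rewrite mulrC divfK // gt_eqF.
have yng2 x y : 0 <= y -> ((p' * (p' / (p' - 1)) * y `^ (p' - 1))%:E * h2 x <=
    ((p' / (p' - 1)) `^ p')%:E * H2 x + ((p' - 1) * y `^ p' * w x)%:E)%E.
  move=> y0; rewrite /h2 /H2; case: (G x) (G0 x) => [r| |] //.
    rewrite lee_fin => r0; rewrite !poweR_EFin -!EFinM -EFinD lee_fin.
    have := young_weighted p'1 y0 (powR_ge0 r (p - 1)) (w_gt0 x).
    by rewrite -powRrM p1p'.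
  move=> _; rewrite !poweRyr ?gt_eqF // gt0_mulye ?lte_fin //.
  rewrite [X in (_ <= X + _)%E]gt0_muley ?addye ?leey // lte_fin p''.
  exact: powR_gt0.
have H2fin : (\int[mu]_x H2 x < +oo)%E.
  by apply: le_lt_trans doob1 _; rewrite lte_mul_pinfty ?lee_fin ?powR_ge0.
have mh2 := mGp (p - 1).
have doob2 := doob p'1 mw mh2 mH2 w_gt0 h20 H20 yng2 w_int H2fin.
have hfin2 := doob_integrand_fin p'1 mw mh2 mH2 w_gt0 h20 H20 yng2 w_int H2fin.
set a2 := average_ratio mu w h2 in doob2.
have a20 I : 0 <= a2 I.
  by rewrite divr_ge0 // fine_ge0 ?integral_ge0 // => x _; rewrite ?lee_fin ?ltW.
pose D := dsup (fun I => (a2 I)%:E).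
have D0 x : (0 <= D x)%E by apply: dsup_ge0 => I; rewrite lee_fin.
have mD : measurable_fun [set: measurableTypeR R] (D : measurableTypeR R -> \bar R).
  exact: measurable_dsup.
have fine_gt0 (u : \bar R) : (0 < u < +oo)%E -> 0 < fine u.
  by move=> u0; exact: fine_gt0.
(* (F / V)^(p-1) is the product of (F / sigma(I))^(p-1) V / W(I) and the A_p quotient W(I)
   sigma(I)^(p-1) / V^p. On I, G is at least F / sigma(I), so the first factor is at most a2 I. *)
have avg_le I : (fine (\int[mu]_(x in @dyadic_set R I) h x)%E / dmass mu I) `^ (p - 1) <=
    A * a2 I.
  set F := fine _; have F0 : 0 <= F by rewrite fine_ge0 ?integral_ge0.
  have V0 := dmass_gt0 mu_nondeg I; have W0 := fine_gt0 _ (w_int I).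
  have S0 := fine_gt0 _ (sigma_int I).
  have B_ge : (F / fine (isg I)) `^ (p - 1) * dmass mu I <=
      fine (\int[mu]_(x in @dyadic_set R I) h2 x)%E.
    rewrite -lee_fin -hfin2 EFinM -(dmassE mu_nondeg) -integral_cst; last first.
      exact: measurable_dyadic_set.
    apply: ge0_le_integral => //; first exact: measurable_dyadic_set.
    - by move=> x _; rewrite lee_fin powR_ge0.
    - exact: measurable_funTS.
    - move=> x Ix; rewrite -poweR_EFin; apply: ge0_le_poweR; first exact: ltW.
        exact: (a10 I).
      exact: (dsup_ge (fun I => (a1 I)%:E)).
  apply: (@le_trans _ _ (A * ((F / fine (isg I)) `^ (p - 1) * dmass mu I / fine (iw I)))).
    rewrite !powRM ?invr_ge0 ?(ltW V0) ?(ltW S0) //.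
    have powVr (u : R) : 0 < u -> u^-1 `^ (p - 1) = (u `^ (p - 1))^-1.
      move=> u0; have up : u `^ (p - 1) != 0 by rewrite gt_eqF ?powR_gt0.
      apply: (mulfI up); rewrite -powRM ?invr_ge0 ?(ltW u0) //.
      by rewrite !mulfV ?powR1 // gt_eqF.
    rewrite !powVr // mulrCA -!mulrA ler_wpM2l ?powR_ge0 //.
    have Sp : 0 < fine (isg I) `^ (p - 1) by exact: powR_gt0.
    have Vp : 0 < dmass mu I `^ (p - 1) by exact: powR_gt0.
    have := dyadic_Ap I.
    have -> : dmass mu I `^ p = dmass mu I `^ (p - 1) * dmass mu I.
      rewrite -{3}[dmass mu I]powRr1 ?(ltW V0) // -powRD ?subrK //.
      by rewrite (lt0r_neq0 V0) implybT.
    move: Sp Vp V0 W0 S0; set s := _ `^ _; set vp := _ `^ _.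
    set v := dmass _ _; set W := fine _ => Sp Vp V0 W0 _ hh.
    rewrite -[leLHS]mul1r ler_pdivrMr //.
    have -> : s^-1 * (v * (A / W)) * vp = A * (vp * v) / (W * s).
      by field; rewrite !lt0r_neq0.
    by rewrite ler_pdivlMr ?mulr_gt0 // mul1r.
  by rewrite ler_wpM2l // /a2 /average_ratio ler_pM2r ?invr_gt0.
have MD x : (dsup (daverage mu (fun z => `|f z|%R)) x `^ p <= (A `^ p')%:E * D x `^ p')%E.
  have AD0 : (0 <= A%:E * D x)%E by rewrite mule_ge0 ?lee_fin.
  have pE (u : \bar R) : (u `^ p = (u `^ (p - 1)) `^ p')%E by rewrite -poweRrM p1p'.
  rewrite -poweR_EFin -poweRM ?lee_fin // pE.
  apply: ge0_le_poweR; [exact: ltW|exact: poweR_ge0|].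
  apply: (@le_trans _ _ (((A%:E * D x) `^ (p - 1)^-1) `^ (p - 1))%E); last first.
    by rewrite -poweRrM mulVf ?gt_eqF // poweRe1.
  apply: ge0_le_poweR; first exact: ltW.
    by apply: dsup_ge0 => I; exact: daverage_ge0.
  apply: dsup_le => I Ix.
  have -> : daverage mu (fun z => `|f z|%R) I =
      (fine (\int[mu]_(x in @dyadic_set R I) h x)%E / dmass mu I)%:E.
    by rewrite /daverage hfin -EFinM mulrC.
  set u := _ / _; have u0 : 0 <= u.
    by rewrite divr_ge0 ?(ltW (dmass_gt0 _ _)) // fine_ge0 ?integral_ge0.
  have -> : u%:E = ((u `^ (p - 1))%:E `^ (p - 1)^-1)%E.
    by rewrite poweR_EFin -powRrM mulfV ?gt_eqF // powRr1.
  apply: ge0_le_poweR; rewrite ?invr_ge0 ?(ltW p1) ?lee_fin ?powR_ge0 //.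
  apply: (@le_trans _ _ (A * a2 I)%:E); first by rewrite lee_fin avg_le.
  by rewrite EFinM lee_wpmul2l ?lee_fin //; exact: (dsup_ge (fun I => (a2 I)%:E)).
have mEw : measurable_fun [set: measurableTypeR R] (EFin \o w : measurableTypeR R -> \bar R).
  exact/measurable_EFinP.
have mMw : measurable_fun [set: measurableTypeR R]
    ((fun x => (D x `^ p' * (w x)%:E)%E) : measurableTypeR R -> \bar R).
  apply: emeasurable_funM => //.
  exact: (measurableT_comp (measurable_poweR p')).
apply: (@le_trans _ _ (\int[mu]_x ((A `^ p')%:E * (D x `^ p' * (w x)%:E)))%E).
  apply: ge0_le_integral => //.
  - by move=> x _; rewrite mule_ge0 ?poweR_ge0 // lee_fin ltW.
  - apply: emeasurable_funM => //; apply: (measurableT_comp (measurable_poweR p)).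
    exact: measurable_dsup.
  - exact: emeasurable_funM.
  - by move=> x _; rewrite muleA lee_wpmul2r // lee_fin ltW.
rewrite ge0_integralZl ?lee_fin ?powR_ge0 //; last first.
  by move=> x _; rewrite mule_ge0 ?poweR_ge0 // lee_fin ltW.
rewrite EFinM -muleA lee_wpmul2l ?lee_fin ?powR_ge0 //.
rewrite p'' in doob2; apply: (le_trans doob2).
by rewrite EFinM -muleA lee_wpmul2l ?lee_fin ?powR_ge0.
Qed.

End DyadicMuckenhoupt.

Section PositiveIntegral.
Context d (T : measurableType d) (R : realType).
Variable mu : {measure set T -> \bar R}.

Lemma integral_gt0_of_gt0 (D : set T) (g : T -> \bar R) : measurable D ->
  measurable_fun D g -> (forall x, D x -> (0 < g x)%E) -> (0 < mu D)%E ->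
  (0 < \int[mu]_(x in D) g x)%E.
Proof.
move=> mD mg g0 D0; rewrite lt0e integral_ge0 ?andbT => [|x /g0/ltW //].
apply/eqP => int0.
have : ae_eq mu D g (cst 0%E).
  apply/ae_eq_integral_abs => //; rewrite -[RHS]int0; apply: eq_integral => x.
  by rewrite inE => /g0/ltW/gee0_abs.
move=> [N [mN N0 DN]]; move: D0; rewrite lt_neqAle => /andP[/eqP + _]; apply.
apply/esym; apply: (subset_measure0 mD mN _ N0) => x Dx; apply: DN => /= /(_ Dx) gx0.
by have := g0 x Dx; rewrite gx0 ltxx.
Qed.

End PositiveIntegral.

(** * Masses of a weight and the A_p^b bounds in real numbers *)

Section WeightFacts.
Variables (R : realType) (mu : {measure set (measurableTypeR R) -> \bar R}).
Variable w : R -> R.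
Hypothesis mu_nondeg : dyadic_nondegenerate mu.
Hypothesis w_weight : weight mu w.
Hypothesis w_gt0 : forall x, 0 < w x.
Implicit Types I J : dyadic.

Local Notation V := (dmass mu).
Local Notation m := (dm mu).
Local Notation iw I := (\int[mu]_(x in @dyadic_set R I) (w x)%:E)%E.

Let mw : measurable_fun [set: measurableTypeR R] (w : measurableTypeR R -> R).
Proof. by case: w_weight. Qed.
Let mD I : measurable (@dyadic_set R I). Proof. exact: measurable_dyadic_set. Qed.
Let mu_gt0 I : (0 < mu (@dyadic_set R I))%E. Proof. by have /andP[] := mu_nondeg I. Qed.

Lemma weight_integral I : (0 < iw I < +oo)%E.
Proof.
have mEw : measurable_fun [set: measurableTypeR R] (EFin \o w : measurableTypeR R -> \bar R).
  exact/measurable_EFinP.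
apply/andP; split.
  apply: integral_gt0_of_gt0 => //; first exact: measurable_funTS.
  by move=> x _; rewrite lte_fin.
have [_ _ h] := w_weight.
pose K : set R := `[2 ^ (- I.1) * I.2%:~R, 2 ^ (- I.1) * (I.2 + 1)%:~R]%classic.
have cK : compact K by exact: segment_compact.
apply: le_lt_trans (h K cK).
rewrite (_ : (\int[mu]_(x in _) `|w x|%:E)%E =
    (\int[mu]_(x in (K : set (measurableTypeR R))) (w x)%:E)%E); last first.
  by apply: eq_integral => x _; rewrite gtr0_norm.
apply: ge0_subset_integral => //.
- exact: measurable_itv.
- exact: measurable_funTS.
- by move=> x _; rewrite lee_fin ltW.
- by move=> x /andP[h1 h2]; rewrite /K /= in_itv /= h1 ltW.
Qed.

Local Notation W I := (fine (iw I)).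

Lemma weight_mass_gt0 I : 0 < W I.
Proof. exact/fine_gt0/weight_integral. Qed.

Lemma weight_massE I : iw I = (W I)%:E.
Proof.
by have /andP[h0 h1] := weight_integral I; rewrite fineK // ge0_fin_numE // ltW.
Qed.

Lemma daverageE f I : (\int[mu]_(x in @dyadic_set R I) (f x)%:E)%E \is a fin_num ->
  daverage mu f I = (fine (\int[mu]_(x in @dyadic_set R I) (f x)%:E)%E / V I)%:E.
Proof. by move=> fin; rewrite /daverage -{1}(fineK fin) -EFinM mulrC. Qed.

Lemma cb_gt0 p I J : 0 < cb mu p I J.
Proof.
rewrite /cb; case: ifP => // _.
by rewrite divr_gt0 // mulr_gt0 ?powR_gt0 ?dm_gt0 ?dmass_gt0.
Qed.

Lemma dm_le_dmass I : m I <= V I.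
Proof. exact: (m_le_V (dmass_gt0 mu_nondeg) (dmass_children mu_nondeg) (fun=> erefl)). Qed.

Lemma powR_split (q r : R) : 0 < r -> q `^ (r / 2) * q `^ (r / 2) = q `^ r.
Proof. by move=> r0; rewrite -powRD -splitr // (gt_eqF r0). Qed.

(* S stands for the (p-1)-st power of the dual weight's mass when p > 1, and for
   the norm of 1/w in L^oo when p = 1. *)
Lemma related_real_form p A (S : dyadic -> R) I J : 0 < p -> 0 <= A -> 0 <= S J ->
  cb mu p I J * (W I / V I) * (S J / V J `^ (p - 1)) <= A ->
  (I = J -> W I * S I <= A * V I `^ p) /\
  W I * S J * (m I `^ (p / 2) * m J `^ (p / 2)) <= A * (V I * V J) `^ p.
Proof.
move=> p0 A0 SJ0 h; have V0 K := dmass_gt0 mu_nondeg K.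
have Vp K : V K `^ p = V K `^ (p - 1) * V K.
  rewrite -{3}[V K]powRr1 ?(ltW (V0 _)) // -powRD ?subrK //.
  by rewrite (lt0r_neq0 (V0 K)) implybT.
have Vp1 K : 0 < V K `^ (p - 1) by exact: powR_gt0.
have diag : I = J -> W I * S I <= A * V I `^ p.
  move=> IJ; move: h; rewrite -IJ /cb eqxx mul1r.
  by rewrite mulrACA -invfM ler_pdivrMr ?mulr_gt0 // [V I * _]mulrC -Vp.
split=> //; have [IJ|neIJ] := eqVneq I J.
  move: (diag IJ); rewrite -IJ => d; rewrite powR_split // powRM ?(ltW (V0 _)) //.
  rewrite mulrA ler_pM ?powR_ge0 //.
    by rewrite mulr_ge0 ?IJ // -?IJ ltW // weight_mass_gt0.
  by rewrite ge0_ler_powR ?nnegrE ?(ltW p0) ?(ltW (dm_gt0 _ _)) ?(ltW (V0 _)) ?dm_le_dmass.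
move: h; rewrite /cb (negbTE neIJ) powRM ?(ltW (V0 _)) // !Vp.
set M := _ * m J `^ _ => h.
rewrite [leLHS](_ : _ = M / (V J * V I `^ (p - 1)) * (W I / V I) *
   (S J / V J `^ (p - 1)) * (V I `^ (p - 1) * V I * (V J `^ (p - 1) * V J))).
  by rewrite ler_pM2r // !mulr_gt0.
by field; rewrite !lt0r_neq0.
Qed.

End WeightFacts.

Lemma ereal_sup_bounded (R : realType) (X : set (\bar R)) :
  (ereal_sup X < +oo)%E -> exists A, 0 <= A /\ forall y, X y -> (y <= A%:E)%E.
Proof.
move=> X_lty; exists (Num.max 0 (fine (ereal_sup X))); split.
  by rewrite le_max lexx.
move=> y Xy; apply: le_trans (ereal_sup_ubound Xy) _.
case: (ereal_sup X) X_lty => [r| |] // _; last by rewrite leNye.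
by rewrite lee_fin le_max lexx orbT.
Qed.

(** * A_p^b implies the strong bound *)

Section ApSufficiency.
Variables (R : realType) (mu : {measure set (measurableTypeR R) -> \bar R}).
Variables (w : R -> R) (p : R).
Hypothesis mu_nondeg : dyadic_nondegenerate mu.
Hypothesis mu_balanced : balanced mu.
Hypothesis w_weight : weight mu w.
Hypothesis w_gt0 : forall x, 0 < w x.
Hypothesis p_gt1 : 1 < p.
Implicit Types I J : dyadic.

Local Notation V := (dmass mu).
Local Notation p' := (p / (p - 1)).
Local Notation sigma := (fun x => w x `^ (1 - p')).
Local Notation iw I := (\int[mu]_(x in @dyadic_set R I) (w x)%:E)%E.
Local Notation isg I := (\int[mu]_(x in @dyadic_set R I) (sigma x)%:E)%E.

Let p0 : 0 < p. Proof. by rewrite (lt_trans ltr01). Qed.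
Let p1 : 0 < p - 1. Proof. by rewrite subr_gt0. Qed.
Let mw : measurable_fun [set: measurableTypeR R] (w : measurableTypeR R -> R).
Proof. by case: w_weight. Qed.
Let mEw : measurable_fun [set: measurableTypeR R] (EFin \o w : measurableTypeR R -> \bar R).
Proof. exact/measurable_EFinP. Qed.
Let w_ge0 x : (0 <= (EFin \o w) x)%E. Proof. by rewrite lee_fin ltW. Qed.
Let mD I : measurable (@dyadic_set R I). Proof. exact: measurable_dyadic_set. Qed.
Let mEs : measurable_fun [set: measurableTypeR R] (EFin \o sigma : measurableTypeR R -> \bar R).
Proof. apply/measurable_EFinP; exact: (measurableT_comp (measurable_powR _)). Qed.
Let sigma_gt0 x : 0 < sigma x. Proof. exact: powR_gt0. Qed.
Let V0 I : 0 < V I. Proof. exact: dmass_gt0. Qed.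

Lemma dual_weight_gt0 I : (0 < isg I)%E.
Proof.
apply: integral_gt0_of_gt0 => //; first exact: measurable_funTS.
  by move=> x _; rewrite lte_fin.
by have /andP[] := mu_nondeg I.
Qed.

(* This instance of Hoelder's inequality comes from integrating Young's inequality
   for the pair (sigma^(1/p), t w^(1/p)) and optimizing in t. *)
Lemma dmass_le_Ap I : (isg I < +oo)%E ->
  V I `^ p <= fine (iw I) * fine (isg I) `^ (p - 1).
Proof.
move=> sfin; have W0 := weight_mass_gt0 mu_nondeg w_weight w_gt0 I.
have Wfin := weight_massE mu_nondeg w_weight w_gt0 I.
have Sfin : isg I = (fine (isg I))%:E.
  by rewrite fineK // ge0_fin_numE // ltW // dual_weight_gt0.
set W := fine (iw I) in W0 Wfin *; set Sg := fine (isg I) in Sfin *.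
(* For this t, t^p W(I) = t V(I), and the integrated inequality becomes t V(I) <= sigma(I). *)
pose t := (V I / W) `^ (p - 1)^-1.
have t0 : 0 <= t by exact: powR_ge0.
have VW0 : 0 < V I / W by rewrite divr_gt0.
have tp1 : t `^ (p - 1) = V I / W by rewrite -powRrM mulVf ?gt_eqF // powRr1 // ltW.
have tp : t `^ p = V I / W * t.
  rewrite -tp1 -{3}[t]powRr1 // -powRD ?subrK //; apply/implyP => _.
  by rewrite gt_eqF // powR_gt0.
have young_t (a b : R) : 0 <= a -> 0 <= b -> a `^ (p - 1) * b = 1 ->
    p * t <= (p - 1) * a `^ p + t `^ p * b `^ p.
  move=> a0 b0 ab; have := young_powR p_gt1 a0 (mulr_ge0 t0 b0).
  by rewrite (powRM _ t0 b0) [X in p * X]mulrCA ab mulr1.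
have root (a : R) : 0 <= a -> (a `^ p^-1) `^ p = a.
  by move=> a0; rewrite -powRrM mulVf ?gt_eqF // powRr1.
have pw x : p * t <= (p - 1) * sigma x + t `^ p * w x.
  have e1 : (sigma x `^ p^-1) `^ (p - 1) * w x `^ p^-1 = 1.
    rewrite -!powRrM -powRD; last by rewrite (lt0r_neq0 (w_gt0 x)) implybT.
    rewrite (_ : _ + _ = 0) ?powRr0 //.
    by field; rewrite !gt_eqF.
  have := young_t _ _ (powR_ge0 _ _) (powR_ge0 _ _) e1.
  by rewrite (root _ (powR_ge0 _ _)) (root _ (ltW (w_gt0 x))).
have : ((p * t)%:E * mu (@dyadic_set R I) <= (p - 1)%:E * isg I + (t `^ p)%:E * iw I)%E.
  rewrite -integral_cst // -!ge0_integralZl ?lee_fin ?powR_ge0 ?(ltW p1) //;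
    try (by apply: measurable_funTS); try (by move=> x _; rewrite lee_fin ltW).
  rewrite -ge0_integralD //; last 4 first.
  - by move=> x _; rewrite mule_ge0 ?lee_fin ?(ltW p1) ?powR_ge0.
  - by apply: measurable_funTS; apply: emeasurable_funM.
  - by move=> x _; rewrite mule_ge0 ?lee_fin ?powR_ge0 ?(ltW (w_gt0 x)).
  - by apply: measurable_funTS; apply: emeasurable_funM.
  apply: ge0_le_integral => //.
  - by move=> x _; rewrite lee_fin mulr_ge0 // ltW.
  - by apply: measurable_funTS; apply: emeasurable_funD; apply: emeasurable_funM.
  - by move=> x _; rewrite -!EFinM -EFinD lee_fin.
rewrite Sfin Wfin (dmassE mu_nondeg) -!EFinM -EFinD lee_fin tp => le.
have {}le : t * V I <= Sg.
  rewrite -(ler_pM2l p1).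
  have e : V I / W * t * W = t * V I by field; rewrite gt_eqF.
  by rewrite e in le; lra.
have : (t * V I) `^ (p - 1) <= Sg `^ (p - 1).
  rewrite ge0_ler_powR ?nnegrE ?(ltW p1) ?mulr_ge0 ?(ltW (V0 _)) //.
  by rewrite (le_trans _ le) // mulr_ge0 // ltW.
rewrite powRM ?(ltW (V0 _)) // tp1 -(ler_pM2l W0); apply: le_trans.
have -> : V I `^ p = V I `^ (p - 1) * V I.
  rewrite -{3}[V I]powRr1 ?(ltW (V0 _)) // -powRD ?subrK //.
  by rewrite (lt0r_neq0 (V0 I)) implybT.
rewrite le_eqVlt; apply/orP; left; apply/eqP; field; exact: lt0r_neq0.
Qed.

Lemma Apb_real_form : Apb mu p w -> exists A, [/\ 0 <= A, forall I, (isg I < +oo)%E &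
  forall I J, b_related I J -> cb mu p I J * (fine (iw I) / V I) *
    (fine (isg J) `^ (p - 1) / V J `^ (p - 1)) <= A].
Proof.
move=> /ereal_sup_bounded[A [A0 hA]]; exists A.
have wE I : daverage mu w I = (fine (iw I) / V I)%:E.
  by apply: daverageE; rewrite (weight_massE mu_nondeg w_weight w_gt0).
have W0 I := weight_mass_gt0 mu_nondeg w_weight w_gt0 I.
have hA' I J : b_related I J -> ((cb mu p I J * (fine (iw I) / V I))%:E *
    daverage mu sigma J `^ (p - 1) <= A%:E)%E.
  by move=> IJ; rewrite EFinM -wE; apply: hA; exists I, J.
(* An infinite dual mass would make the diagonal term infinite. This comes first because [fine]
   sends +oo to 0. *)
have sfin I : (isg I < +oo)%E.
  rewrite ltNge leye_eq; apply/negP => /eqP soo.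
  have II : b_related I I by left; constructor 1.
  have := hA' I I II; rewrite /daverage soo gt0_muley ?lte_fin ?invr_gt0 //.
  rewrite poweRyr ?gt_eqF // gt0_muley ?leye_eq // lte_fin mulr_gt0 ?cb_gt0 //.
  by rewrite divr_gt0.
split=> // I J IJ; have S0 := fine_ge0 (ltW (dual_weight_gt0 J)).
have := hA' I J IJ; rewrite (daverageE (f := sigma)); last first.
  by rewrite ge0_fin_numE // ltW // dual_weight_gt0.
rewrite poweR_EFin -EFinM lee_fin powRM ?invr_ge0 ?(ltW (V0 _)) //.
suff -> : (V J)^-1 `^ (p - 1) = (V J `^ (p - 1))^-1 by [].
have Vp : V J `^ (p - 1) != 0 by rewrite gt_eqF ?powR_gt0.
apply: (mulfI Vp); rewrite -powRM ?invr_ge0 ?(ltW (V0 _)) //.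
by rewrite !mulfV ?powR1 // gt_eqF.
Qed.

Lemma Apb_bounded_dmaximal N : Apb mu p w -> bounded_on_wLp mu (dmaximal mu N) w p.
Proof.
move=> /Apb_real_form[A [A0 sfin hA]].
have sint I : (0 < isg I < +oo)%E by rewrite dual_weight_gt0 sfin.
have sE I : isg I = (fine (isg I))%:E by rewrite fineK // ge0_fin_numE // ltW // dual_weight_gt0.
have sg0 I : 0 < fine (isg I) by exact/fine_gt0/sint.
pose S I := fine (isg I) `^ (p - 1).
have S0 I : 0 < S I by exact: powR_gt0.
have rel I J (IJ : b_related I J) := related_real_form mu_nondeg w_weight w_gt0
  p0 A0 (ltW (S0 J)) (hA I J IJ).
have WSV I : fine (iw I) * S I <= A * V I `^ p.
  by apply: (rel I I _).1 => //; left; constructor 1.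
have Spar I : S I <= S (dparent I).
  apply: ge0_ler_powR; rewrite ?nnegrE ?(ltW p1) ?(ltW (sg0 _)) //.
  rewrite -lee_fin -!sE; apply: ge0_subset_integral => //.
  - exact: measurable_funTS.
  - by move=> x _; rewrite lee_fin ltW.
  - exact: sub_dparent.
have [c [c1 bal]] := mu_balanced.2.
have wint := weight_integral mu_nondeg w_weight w_gt0.
pose nu := density mu mEw w_ge0.
have nu0 I : (0 < nu (@dyadic_set R I))%E by have /andP[] := wint I.
have nuoo I : (nu (@dyadic_set R I) < +oo)%E by have /andP[] := wint I.
have [C [C0 hC]] := dmaximal_superlevel_le mu_nondeg c1 bal p0 A0 nu0 nuoo S0 Spar
  (fun I => dmass_le_Ap (sfin I)) WSV (fun I J IJ => (rel I J IJ).2) N.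
have [K [K0 hK]] := dyadic_muckenhoupt mu_nondeg p_gt1 A0 mw w_gt0 wint sint WSV.
(* C comes from the measures of the level sets, C^p from the dilation of the levels, and K from the
   dyadic maximal function. *)
pose L := C * C `^ p * K.
have L0 : 0 <= L by rewrite !mulr_ge0 ?powR_ge0 // ltW.
exists (L `^ p^-1); split=> [|f [mf ffin]]; first exact: powR_ge0.
rewrite /wLnorm -poweR_EFin -poweRM ?lee_fin //; last first.
  by apply: integral_ge0 => x _; rewrite mule_ge0 ?poweR_ge0 // lee_fin ltW.
apply: ge0_le_poweR; first by rewrite invr_ge0 ltW.
  by apply: integral_ge0 => x _; rewrite mule_ge0 ?poweR_ge0 // lee_fin ltW.
have fE : (\int[mu]_x (`|(EFin \o f) x| `^ p * (w x)%:E) =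
    \int[mu]_x ((`|f x| `^ p)%R * w x)%:E)%E.
  by apply: eq_integral.
have {}ffin : (\int[mu]_x ((`|f x| `^ p)%R * w x)%:E < +oo)%E.
  by rewrite -fE; apply: lty_poweRy ffin; rewrite invr_eq0 gt_eqF.
have M0 x := dmaximal_ge0 mu_nondeg N f x.
pose Md := dsup (daverage mu (fun z => `|f z|%R)).
have Md0 x : (0 <= Md x)%E by apply: dsup_ge0 => I; exact: daverage_ge0.
have mMd : measurable_fun [set: measurableTypeR R] (Md : measurableTypeR R -> \bar R).
  exact: measurable_dsup.
have mM := measurable_dmaximal mu_nondeg N f.
have mpow (g : R -> \bar R) :
    measurable_fun [set: measurableTypeR R] (g : measurableTypeR R -> \bar R) ->
    measurable_fun [set: measurableTypeR R] ((fun x => (g x `^ p)%E) : measurableTypeR R -> \bar R).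
  by move=> mg; exact: (measurableT_comp (measurable_poweR p)).
rewrite fE (eq_integral (fun x : measurableTypeR R =>
  (dmaximal mu N f x `^ p * (w x)%:E)%E)); last first.
  by move=> x _; rewrite gee0_abs.
apply: (@le_trans _ _ (C%:E * \int[mu]_x ((C `^ p)%:E * Md x `^ p * (w x)%:E))%E).
  apply: (@integral_le_of_levels _ (measurableTypeR R) R mu w mw (fun x => ltW (w_gt0 x))
    (fun x => dmaximal mu N f x `^ p)%E (fun x => (C `^ p)%:E * Md x `^ p)%E).
  - exact: mpow.
  - by apply: emeasurable_funM => //; exact: mpow.
  - by move=> x; exact: poweR_ge0.
  - by move=> x; rewrite mule_ge0 ?poweR_ge0 ?lee_fin ?powR_ge0.
  - exact: ltW.
  (* Level t of the two p-th powers compared is level C s of M^N f and level s of the dyadic maximal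
     function. *)
  move=> t t0; pose s := t `^ p^-1 / C.
  have s0 : 0 < s by rewrite divr_gt0 ?powR_gt0.
  have -> : [set x | (t%:E < dmaximal mu N f x `^ p)%E] =
      [set x | ((C * s)%:E < dmaximal mu N f x)%E].
    apply/seteqP; split=> x /=; rewrite lt_poweR_real ?(ltW t0) //;
      by rewrite /s mulrCA mulfV ?gt_eqF // mulr1.
  have -> : [set x | (t%:E < (C `^ p)%:E * Md x `^ p)%E] = [set x | (s%:E < Md x)%E].
    have tE x : (t%:E < (C `^ p)%:E * Md x `^ p)%E = (s%:E < Md x)%E.
      rewrite -poweR_EFin -poweRM ?lee_fin ?(ltW C0) // lt_poweR_real ?(ltW t0) //; last first.
        by rewrite mule_ge0 ?lee_fin ?(ltW C0).
      have -> : t `^ p^-1 = C * s by rewrite /s mulrCA mulfV ?gt_eqF // mulr1.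
      by rewrite EFinM lte_pmul2l ?lte_fin.
    by apply/seteqP; split=> x /=; rewrite tE.
  exact: hC.
rewrite [X in (C%:E * X)%E](_ : _ =
  ((C `^ p)%:E * \int[mu]_x (Md x `^ p * (w x)%:E))%E); last first.
  rewrite -ge0_integralZl ?lee_fin ?powR_ge0 //.
  - by apply: eq_integral => x _; rewrite muleA.
  - by apply: emeasurable_funM => //; exact: mpow.
  - by move=> x _; rewrite mule_ge0 ?poweR_ge0 // lee_fin ltW.
rewrite /L !EFinM -!muleA lee_wpmul2l ?lee_fin ?(ltW C0) // lee_wpmul2l ?lee_fin ?powR_ge0 //.
exact: hK.
Qed.

End ApSufficiency.

(** * A_1^b implies the weak bound *)

Section A1Sufficiency.
Variables (R : realType) (mu : {measure set (measurableTypeR R) -> \bar R}).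
Variable w : R -> R.
Hypothesis mu_nondeg : dyadic_nondegenerate mu.
Hypothesis mu_balanced : balanced mu.
Hypothesis w_weight : weight mu w.
Hypothesis w_gt0 : forall x, 0 < w x.
Implicit Types I J : dyadic.

Local Notation V := (dmass mu).
Local Notation iw I := (\int[mu]_(x in @dyadic_set R I) (w x)%:E)%E.
Local Notation sup_inv I :=
  ('N[mu]_+oo[(fun x : measurableTypeR R => ((w x)^-1)%:E) \_ (@dyadic_set R I)])%E.

Let mw : measurable_fun [set: measurableTypeR R] (w : measurableTypeR R -> R).
Proof. by case: w_weight. Qed.
Let mEw : measurable_fun [set: measurableTypeR R] (EFin \o w : measurableTypeR R -> \bar R).
Proof. exact/measurable_EFinP. Qed.
Let w_ge0 x : (0 <= (EFin \o w) x)%E. Proof. by rewrite lee_fin ltW. Qed.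
Let mD I : measurable (@dyadic_set R I). Proof. exact: measurable_dyadic_set. Qed.
Let V0 I : 0 < V I. Proof. exact: dmass_gt0. Qed.
Let muD I : (0 < mu (@dyadic_set R I))%E.
Proof. by have /andP[] := mu_nondeg I. Qed.

Lemma sup_inv_leP I y : (0 <= y)%E -> (sup_inv I <= y)%E <->
  {ae mu, forall x, @dyadic_set R I x -> (((w x)^-1)%:E <= y)%E}.
Proof.
move=> y0; rewrite unlock.
(* The L^oo norm is defined as 0 over a null space and as an essential supremum otherwise. *)
have -> : (0 < mu [set: measurableTypeR R])%E.
  by apply: lt_le_trans (muD I) _; apply: le_measure; rewrite ?inE.
have wi x : 0 <= (w x)^-1 by rewrite invr_ge0 ltW.
split=> [/ess_sup_inf.ess_supP h|h].
  apply: filterS h => x /= + Ix; rewrite patchE mem_set //.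
  by rewrite gee0_abs ?lee_fin.
apply/ess_sup_inf.ess_supP; apply: filterS h => x /= h; rewrite patchE.
case: ifPn => [|_]; last by rewrite abse0.
by rewrite inE gee0_abs ?lee_fin.
Qed.

Lemma sup_inv_ge0 I : (0 <= sup_inv I)%E.
Proof. exact: Lnorm_ge0. Qed.

Lemma le_sup_inv I : {ae mu, forall x, @dyadic_set R I x -> (((w x)^-1)%:E <= sup_inv I)%E}.
Proof. by apply/sup_inv_leP; [exact: sup_inv_ge0|]. Qed.

Lemma sup_inv_gt0 I : (0 < sup_inv I)%E.
Proof.
rewrite lt_neqAle sup_inv_ge0 andbT; apply/negP => /eqP s0.
have [N [mN N0 sub]] := le_sup_inv I.
have := muD I; rewrite (subset_measure0 (mD I) mN _ N0) ?ltxx // => x Ix.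
apply: sub => /= /(_ Ix); rewrite -s0 lee_fin invr_le0 leNgt.
by rewrite w_gt0.
Qed.

(** Almost everywhere on I, 1 is at most w times the norm of 1/w. This takes the place of Hoelder's
    inequality: g = 1 gives V <= W S, and g = |f| the weak bound. *)
Lemma integral_le_sup_inv I (g : R -> R) :
  measurable_fun [set: measurableTypeR R] (g : measurableTypeR R -> R) ->
  (forall x, 0 <= g x) -> (sup_inv I < +oo)%E ->
  (\int[mu]_(x in @dyadic_set R I) (g x)%:E <=
   sup_inv I * \int[mu]_(x in @dyadic_set R I) (g x * w x)%:E)%E.
Proof.
move=> mg g0 sfin.
have sE : sup_inv I = (fine (sup_inv I))%:E by rewrite fineK // ge0_fin_numE // sup_inv_ge0.
have mgw : measurable_fun (@dyadic_set R I)
    ((fun x => (g x * w x)%:E) : measurableTypeR R -> \bar R).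
  by apply: measurable_funTS; apply/measurable_EFinP/measurable_funM.
rewrite -ge0_integralZl ?sup_inv_ge0 //; last first.
  by move=> x _; rewrite lee_fin mulr_ge0 // ltW.
apply: ae_ge0_le_integral => //.
- by move=> x _; rewrite lee_fin.
- by apply: measurable_funTS; exact/measurable_EFinP.
- by move=> x _; rewrite mule_ge0 ?sup_inv_ge0 ?lee_fin ?mulr_ge0 // ltW.
- exact: emeasurable_funM.
apply: filterS (le_sup_inv I) => x h Ix; have := h Ix.
rewrite sE !lee_fin => le; rewrite mulrCA ler_peMr // -(mulVf (lt0r_neq0 (w_gt0 x))).
by rewrite ler_wpM2r // ltW.
Qed.

Local Notation S I := (fine (sup_inv I)).

Lemma A1b_real_form : A1b mu w -> exists A, [/\ 0 <= A, forall I, (sup_inv I < +oo)%E &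
  forall I J, b_related I J -> cb mu 1 I J * (fine (iw I) / V I) *
    (S J / V J `^ (1 - 1)) <= A].
Proof.
move=> /ereal_sup_bounded[A [A0 hA]]; exists A.
have wE I : daverage mu w I = (fine (iw I) / V I)%:E.
  by apply: daverageE; rewrite (weight_massE mu_nondeg w_weight w_gt0).
have W0 I := weight_mass_gt0 mu_nondeg w_weight w_gt0 I.
have hA' I J : b_related I J -> ((cb mu 1 I J * (fine (iw I) / V I))%:E *
    sup_inv J <= A%:E)%E.
  by move=> IJ; rewrite EFinM -wE; apply: hA; exists I, J.
have sfin I : (sup_inv I < +oo)%E.
  rewrite ltNge leye_eq; apply/negP => /eqP soo.
  have II : b_related I I by left; constructor 1.
  have := hA' I I II; rewrite soo gt0_muley ?leye_eq // lte_fin mulr_gt0 ?cb_gt0 //.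
  by rewrite divr_gt0.
split=> // I J IJ; have := hA' I J IJ.
have -> : sup_inv J = (S J)%:E by rewrite fineK // ge0_fin_numE // sup_inv_ge0.
by rewrite -EFinM lee_fin subrr powRr0 divr1.
Qed.

Lemma A1b_bounded_dmaximal N : A1b mu w -> bounded_wL1_weak mu (dmaximal mu N) w.
Proof.
move=> /A1b_real_form[A [A0 sfin hA]].
have sE I : sup_inv I = (S I)%:E by rewrite fineK // ge0_fin_numE // sup_inv_ge0.
have S0 I : 0 < S I by apply: fine_gt0; rewrite sup_inv_gt0 sfin.
have rel I J (IJ : b_related I J) := related_real_form (S := fun K => S K)
  mu_nondeg w_weight w_gt0 ltr01 A0 (ltW (S0 J)) (hA I J IJ).
have WSV I : fine (iw I) * S I <= A * V I `^ 1.
  by apply: (rel I I _).1 => //; left; constructor 1.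
have Spar I : S I <= S (dparent I).
  rewrite -lee_fin -!sE; apply/sup_inv_leP; first exact: sup_inv_ge0.
  apply: filterS (le_sup_inv (dparent I)) => x h Ix; apply: h; exact: sub_dparent.
have wE := weight_massE mu_nondeg w_weight w_gt0.
have VWS I : V I `^ 1 <= fine (iw I) * S I.
  have := integral_le_sup_inv (g := cst 1) (measurable_cst _) (fun=> ler01) (sfin I).
  have -> : (\int[mu]_(x in @dyadic_set R I) (cst 1 x)%:E = (V I)%:E)%E.
    by rewrite -(dmassE mu_nondeg) -[RHS]mul1e -integral_cst.
  have -> : (\int[mu]_(x in @dyadic_set R I) (cst 1 x * w x)%:E = iw I)%E.
    by apply: eq_integral => x _; rewrite mul1r.
  by rewrite wE sE -EFinM lee_fin mulrC powRr1 // ltW.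
have [c [c1 bal]] := mu_balanced.2.
have wint := weight_integral mu_nondeg w_weight w_gt0.
pose nu := density mu mEw w_ge0.
have nu0 I : (0 < nu (@dyadic_set R I))%E by have /andP[] := wint I.
have nuoo I : (nu (@dyadic_set R I) < +oo)%E by have /andP[] := wint I.
have [C [C0 hC]] := dmaximal_superlevel_le (S := fun K => S K)
  mu_nondeg c1 bal ltr01 A0 nu0 nuoo S0 Spar
  VWS WSV (fun I J IJ => (rel I J IJ).2) N.
exists (C * C * A); split=> [|f [mf ffin]]; first by rewrite !mulr_ge0 // ltW.
have fE : wLnorm mu w 1 (EFin \o f) = (\int[mu]_x (`|f x| * w x)%:E)%E.
  rewrite /wLnorm invr1 poweRe1; last first.
    by apply: integral_ge0 => x _; rewrite mule_ge0 ?poweR_ge0 // lee_fin ltW.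
  by apply: eq_integral => x _; rewrite poweRe1 ?abse_ge0.
rewrite fE; rewrite fE in ffin.
have mfw : measurable_fun [set: measurableTypeR R]
    ((fun x => (`|f x| * w x)%:E) : measurableTypeR R -> \bar R).
  by apply/measurable_EFinP/measurable_funM => //; exact: measurableT_comp.
have mabs : measurable_fun [set: measurableTypeR R] ((fun x => `|f x|) : measurableTypeR R -> R).
  exact: measurableT_comp.
have fw0 x : (0 <= (`|f x| * w x)%:E)%E by rewrite lee_fin mulr_ge0 // ltW.
have M0 x := dmaximal_ge0 mu_nondeg N f x.
(* If the average over I exceeds s, then s V(I) < S(I) T with T the integral of |f| w over I.
   Multiplying by W(I) and using W S <= A V gives W(I) <= (A / s) T, which [covering] sums. *)
have weak s : 0 < s -> (nu [set x | (s%:E < dsup (daverage mu (fun z => `|f z|%R)) x)%E] <=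
    (A / s)%:E * \int[mu]_x (`|f x| * w x)%:E)%E.
  move=> s0; rewrite dsup_superlevel.
  apply: (@le_trans _ _ ((A / s)%:E * density mu mfw fw0
    (\bigcup_(I in [set I | (s%:E < daverage mu (fun z => `|f z|%R) I)%E]) @dyadic_set R I))%E).
    apply: covering => [||I J _ _|I /= sI]; first by rewrite divr_ge0 // ltW.
    - exact: mD.
    - exact: dyadic_le_sub.
    have := integral_le_sup_inv mabs (fun x => normr_ge0 (f x)) (sfin I).
    set T := (\int[mu]_(x in @dyadic_set R I) (`|f x| * w x)%:E)%E => FT.
    have T0 : (0 <= T)%E by apply: integral_ge0.
    have Tfin : (T < +oo)%E.
      by apply: le_lt_trans ffin; apply: ge0_subset_integral.
    have TE : T = (fine T)%:E by rewrite fineK // ge0_fin_numE.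
    change (iw I <= (A / s)%:E * T)%E.
    have sVT : s * V I < S I * fine T.
      rewrite -lte_fin [in ltRHS]EFinM -sE -TE; apply: lt_le_trans FT.
      move: sI; rewrite /daverage -(@lte_pmul2l _ (V I)%:E) ?lte_fin //.
      by rewrite [in ltRHS]muleA -!EFinM mulfV ?gt_eqF // mul1e mulrC.
    rewrite TE wE -EFinM lee_fin.
    have W0 := weight_mass_gt0 mu_nondeg w_weight w_gt0 I.
    rewrite mulrAC ler_pdivlMr // -(ler_pM2r (V0 I)) -mulrA.
    rewrite (le_trans (ler_wpM2l (ltW W0) (ltW sVT))) // mulrA.
    rewrite [leRHS]mulrAC ler_wpM2r ?fine_ge0 //.
    by have := WSV I; rewrite powRr1 // ltW.
  rewrite lee_wpmul2l ?lee_fin ?divr_ge0 ?(ltW s0) //.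
  apply: ge0_subset_integral => //.
  exact: bigcup_countType_measurable.
apply: ge_ereal_sup => _ [t [t0 ->]].
pose s := t / C; have s0 : 0 < s by rewrite divr_gt0.
have -> : [set x : measurableTypeR R | (t%:E < `|dmaximal mu N f x|)%E] =
    [set x | ((C * s)%:E < dmaximal mu N f x)%E].
  by apply/seteqP; split=> x /=; rewrite gee0_abs // /s mulrCA mulfV ?gt_eqF // mulr1.
have := hC f s mf s0 => h.
apply: (@le_trans _ _ (t%:E * (C%:E * ((A / s)%:E * \int[mu]_x (`|f x| * w x)%:E)))%E).
  rewrite lee_wpmul2l ?lee_fin ?(ltW t0) //; apply: (le_trans h).
  by rewrite lee_wpmul2l ?lee_fin ?(ltW C0) // weak.
rewrite !muleA -!EFinM le_eqVlt; apply/orP; left; apply/eqP; congr (_%:E * _)%E.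
by rewrite /s; field; rewrite !lt0r_neq0.
Qed.

End A1Sufficiency.

(** * Necessity of the conditions, by test functions *)

Section Necessity.
Variables (R : realType) (mu : {measure set (measurableTypeR R) -> \bar R}).
Variables (w : R -> R) (N : nat).
Hypothesis mu_nondeg : dyadic_nondegenerate mu.
Hypothesis w_weight : weight mu w.
Hypothesis w_gt0 : forall x, 0 < w x.
Hypothesis N_ge1 : (1 <= N)%N.
Implicit Types I J : dyadic.

Local Notation V := (dmass mu).
Local Notation m := (dm mu).
Local Notation iw I := (\int[mu]_(x in @dyadic_set R I) (w x)%:E)%E.
Local Notation W I := (fine (iw I)).

Let mw : measurable_fun [set: measurableTypeR R] (w : measurableTypeR R -> R).
Proof. by case: w_weight. Qed.
Let mEw : measurable_fun [set: measurableTypeR R] (EFin \o w : measurableTypeR R -> \bar R).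
Proof. exact/measurable_EFinP. Qed.
Let mD I : measurable (@dyadic_set R I). Proof. exact: measurable_dyadic_set. Qed.
Let V0 I : 0 < V I. Proof. exact: dmass_gt0. Qed.
Let W0 I : 0 < W I. Proof. exact: weight_mass_gt0. Qed.
Let WE I : iw I = (W I)%:E. Proof. exact: weight_massE. Qed.
Let wE I : daverage mu w I = (W I / V I)%:E.
Proof. by apply: daverageE; rewrite WE. Qed.
Let near_related I J : b_related I J -> (ddist R J I <= (N + 2)%:R%:E)%E.
Proof.
by move=> IJ; apply: ddist_related; [rewrite addn2|exact: b_related_sym].
Qed.

(* The pairs (I, J) and (J, I) exchange the roles of the weight and of its dual. *)
Lemma cb_swap p I J : 0 < p ->
  cb mu p I J / V I / V J `^ (p - 1) = cb mu 1 J I `^ p / V J `^ p.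
Proof.
move=> p0; have Vp K : V K `^ p = V K `^ (p - 1) * V K.
  rewrite -{3}[V K]powRr1 ?(ltW (V0 _)) // -powRD ?subrK //.
  by rewrite (lt0r_neq0 (V0 K)) implybT.
have Vp1 K : V K `^ (p - 1) != 0 by rewrite gt_eqF ?powR_gt0.
have VN0 K : V K != 0 by rewrite gt_eqF.
rewrite /cb [J == I]eq_sym; case: eqVneq => [->|_].
  by rewrite powR1 Vp; field; rewrite VN0 Vp1.
rewrite subrr powRr0 mulr1 powRM ?invr_ge0 ?mulr_ge0 ?powR_ge0 ?(ltW (V0 _)) //.
rewrite powRM ?powR_ge0 // -!powRrM ![1 / 2 * p]mulrAC !mul1r.
have -> : (V I)^-1 `^ p = (V I `^ p)^-1.
  have VpN0 : V I `^ p != 0 by rewrite gt_eqF ?powR_gt0.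
  apply: (mulfI VpN0); rewrite -powRM ?invr_ge0 ?(ltW (V0 _)) //.
  by rewrite !mulfV ?powR1.
by rewrite !Vp; field; rewrite !VN0 !Vp1.
Qed.

Lemma bounded_dmaximal_Apb p : 1 < p ->
  bounded_on_wLp mu (dmaximal mu N) w p -> Apb mu p w.
Proof.
move=> p_gt1 [C [C0 hC]].
have p0 : 0 < p by rewrite (lt_trans ltr01).
have p1 : 0 < p - 1 by rewrite subr_gt0.
pose sigma x := w x `^ (1 - p / (p - 1)).
have sigma_gt0 x : 0 < sigma x by exact: powR_gt0.
have ms : measurable_fun [set: measurableTypeR R] (sigma : measurableTypeR R -> R).
  exact: (measurableT_comp (measurable_powR _)).
have sigma_w x : sigma x `^ p * w x = sigma x.
  rewrite -powRrM -{2}[w x]powRr1 ?(ltW (w_gt0 _)) // -powRD; last first.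
    by rewrite (lt0r_neq0 (w_gt0 x)) implybT.
  by congr (_ `^ _); field; exact: lt0r_neq0.
suff key I J : b_related I J -> ((cb mu p I J)%:E * daverage mu w I *
    daverage mu sigma J `^ (p - 1) <= (C `^ p)%:E)%E.
  apply: (@le_lt_trans _ _ (C `^ p)%:E); last exact: ltry.
  by apply: ge_ereal_sup => _ [I [J [IJ ->]]]; exact: key.
move=> IJ.
(* The dual weight is not yet known to be integrable over J, so it is truncated at height n. *)
pose D n := @dyadic_set R J `&` [set x : measurableTypeR R | sigma x <= n%:R].
have mDn n : measurable (D n).
  apply: measurableI => //; rewrite -[X in measurable X]setTI.
  exact: (ms measurableT _ (measurable_itv `]-oo, n%:R])).
pose f n x := sigma x * \1_(D n) x.
have f0 n x : 0 <= f n x by rewrite mulr_ge0 // ltW.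
have mf n : measurable_fun [set: measurableTypeR R] (f n : measurableTypeR R -> R).
  by apply: measurable_funM => //; exact: measurable_indic.
have mEf n : measurable_fun [set: measurableTypeR R] (EFin \o f n : measurableTypeR R -> \bar R).
  exact/measurable_EFinP.
have fJ n : (\int[mu]_x (f n x)%:E = \int[mu]_(x in @dyadic_set R J) (f n x)%:E)%E.
  rewrite [RHS]integral_mkcond; apply: eq_integral => x _; rewrite patchE /f.
  case: ifPn => // /negP xJ; rewrite indicE memNset ?mulr0 //.
  by move=> [Jx _]; apply: xJ; rewrite inE.
have ffin n : (\int[mu]_x (f n x)%:E < +oo)%E.
  rewrite fJ; apply: (@le_lt_trans _ _ (n%:R%:E * mu (@dyadic_set R J))%E).
    rewrite -integral_cst //; apply: ge0_le_integral => //.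
    - by move=> x _; rewrite lee_fin.
    - exact: (measurable_funTS (mEf n)).
    - move=> x _; rewrite lee_fin /f indicE; case: (boolP (x \in D n)); last by rewrite mulr0.
      by rewrite inE mulr1 => -[].
  by rewrite (dmassE mu_nondeg) -EFinM ltry.
pose T n := fine (\int[mu]_x (f n x)%:E)%E.
have T0 n : 0 <= T n by apply/fine_ge0/integral_ge0 => x _; rewrite lee_fin.
have TE n : (\int[mu]_x (f n x)%:E)%E = (T n)%:E.
  by rewrite fineK // ge0_fin_numE // integral_ge0 // => x _; rewrite lee_fin.
(* Since sigma^p w = sigma, the p-th power of the norm of f n is its integral T n. *)
have fp n x : `|f n x| `^ p * w x = f n x.
  rewrite ger0_norm // /f indicE; case: (x \in D n); first by rewrite !mulr1.
  by rewrite !mulr0 powR0 ?mul0r // gt_eqF.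
have fnorm n : wLnorm mu w p (EFin \o f n) = ((T n) `^ p^-1)%:E.
  rewrite /wLnorm -poweR_EFin -TE; congr (_ `^ _)%E; apply: eq_integral => x _.
  by rewrite -[in RHS](fp n x).
pose k := cb mu p I J * (W I / V I).
have k0 : 0 < k by rewrite mulr_gt0 ?cb_gt0 ?divr_gt0.
have M0 g x := dmaximal_ge0 mu_nondeg N g x.
(* M^N f is at least l on I, so l^p W(I) <= C^p T n. Division by T n and [cb_swap] turn this into
   the A_p^b product of the truncation. *)
have bound n : k * (T n / V J) `^ (p - 1) <= C `^ p.
  have [Tn0|Tn0] := eqVneq (T n) 0.
    by rewrite Tn0 mul0r powR0 ?mulr0 ?powR_ge0 // gt_eqF.
  have Tn : 0 < T n by rewrite lt0r Tn0 T0.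
  pose l := cb mu 1 J I * (T n / V J).
  have l0 : 0 <= l by rewrite mulr_ge0 ?cb_ge0 ?divr_ge0 // ltW.
  have Ml x : @dyadic_set R I x -> (l%:E <= dmaximal mu N (f n) x)%E.
    move=> Ix; have := dmaximal_ge mu_nondeg (f n) (near_related IJ) Ix.
    apply: le_trans; rewrite /l EFinM lee_wpmul2l ?lee_fin ?cb_ge0 //.
    rewrite /daverage mulrC EFinM lee_wpmul2l ?lee_fin ?invr_ge0 ?(ltW (V0 _)) //.
    rewrite -TE fJ le_eqVlt; apply/orP; left; apply/eqP; apply: eq_integral => x' _.
    by rewrite ger0_norm.
  have : (wLnorm mu w p (dmaximal mu N (f n)) <= C%:E * wLnorm mu w p (EFin \o f n))%E.
    by apply: hC; split=> //; rewrite fnorm ltry.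
  rewrite fnorm -EFinM => le.
  have : ((l `^ p * W I)%:E <= (C `^ p * T n)%:E)%E.
    apply: (@le_trans _ _ (wLnorm mu w p (dmaximal mu N (f n)) `^ p)%E).
      rewrite /wLnorm -poweRrM mulVf ?gt_eqF // poweRe1; last first.
        by apply: integral_ge0 => x _; rewrite mule_ge0 ?poweR_ge0 // lee_fin ltW.
      rewrite EFinM -WE -ge0_integralZl ?lee_fin ?powR_ge0 //; last 2 first.
      - exact: measurable_funTS.
      - by move=> x _; rewrite lee_fin ltW.
      have mMp : measurable_fun [set: measurableTypeR R]
          ((fun x => (`|dmaximal mu N (f n) x| `^ p * (w x)%:E)%E) : measurableTypeR R -> \bar R).
        apply: emeasurable_funM => //; apply: (measurableT_comp (measurable_poweR p)).
        by apply: measurableT_comp => //; exact: measurable_dmaximal.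
      apply: (@le_trans _ _ (\int[mu]_(x in @dyadic_set R I)
          (`|dmaximal mu N (f n) x| `^ p * (w x)%:E))%E).
        apply: ge0_le_integral => //.
        - by move=> x _; rewrite mule_ge0 ?lee_fin ?powR_ge0 // ltW.
        - by apply: measurable_funTS; exact: emeasurable_funM.
        - exact: measurable_funTS.
        - move=> x Ix; rewrite lee_wpmul2r ?lee_fin ?(ltW (w_gt0 _)) //.
          by rewrite gee0_abs // -poweR_EFin ge0_le_poweR ?(ltW p0) ?lee_fin // Ml.
      apply: ge0_subset_integral => //.
      by move=> x _; rewrite mule_ge0 ?poweR_ge0 // lee_fin ltW.
    apply: (@le_trans _ _ ((C * T n `^ p^-1)%:E `^ p)%E).
      by apply: ge0_le_poweR => //; [exact: ltW|exact: poweR_ge0].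
    by rewrite poweR_EFin powRM ?powR_ge0 // -powRrM mulVf ?gt_eqF // powRr1.
  rewrite lee_fin => le'.
  rewrite -(ler_pM2r Tn); apply: le_trans le'; rewrite le_eqVlt; apply/orP; left; apply/eqP.
  have TV0 := divr_ge0 (T0 n) (ltW (V0 J)).
  rewrite /k /l (powRM _ (cb_ge0 mu_nondeg _ _ _) TV0).
  have inv r : (V J)^-1 `^ r = (V J `^ r)^-1.
    have VpN0 : V J `^ r != 0 by rewrite gt_eqF ?powR_gt0.
    apply: (mulfI VpN0); rewrite -powRM ?invr_ge0 ?(ltW (V0 _)) //.
    by rewrite !mulfV ?powR1 // gt_eqF.
  rewrite !powRM ?invr_ge0 ?(ltW (V0 _)) // !inv.
  have -> : T n `^ p = T n `^ (p - 1) * T n.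
    rewrite -{3}[T n]powRr1 // -powRD ?subrK //.
    by rewrite Tn0 implybT.
  transitivity (cb mu p I J / V I / V J `^ (p - 1) * W I * (T n `^ (p - 1) * T n)).
    by ring.
  by rewrite cb_swap //; ring.
(* The value of T n for which [bound] is an equality; it does not depend on n. *)
pose B := V J * (C `^ p / k) `^ (p - 1)^-1.
have B0 : 0 <= B by rewrite mulr_ge0 ?powR_ge0 // ltW.
have TB n : T n <= B.
  rewrite -ler_pdivrMl // mulrC.
  have TV0 := divr_ge0 (T0 n) (ltW (V0 J)).
  have -> : T n / V J = ((T n / V J) `^ (p - 1)) `^ (p - 1)^-1.
    by rewrite -powRrM mulfV ?gt_eqF // powRr1.
  apply: ge0_ler_powR; rewrite ?nnegrE ?invr_ge0 ?powR_ge0 ?(ltW p1) //.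
    by rewrite divr_ge0 ?powR_ge0 // ltW.
  by rewrite ler_pdivlMr // mulrC.
have sB : (\int[mu]_(x in @dyadic_set R J) (sigma x)%:E <= B%:E)%E.
  rewrite [leLHS]integral_mkcond.
  apply: (@integral_le_of_lower_limit _ (measurableTypeR R) R mu _ (fun n x => (f n x)%:E)) => //.
  - apply/measurable_restrict => //; apply: measurable_funTS; exact/measurable_EFinP.
  - by move=> x; rewrite patchE; case: ifP => // _; rewrite lee_fin ltW.
  - move=> x r r0; rewrite patchE; case: ifPn => [xJ|_]; last by rewrite lte_fin ltNge r0.
    rewrite lte_fin => /ltW rs; exists (Num.bound (sigma x)) => n xn.
    rewrite /f indicE mem_set ?mulr1 ?lee_fin //; split; first by rewrite inE in xJ.
    rewrite /= (le_trans (ltW (archi_boundP (ltW (sigma_gt0 x))))) //.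
    by rewrite ler_nat.
  - by move=> n; rewrite TE lee_fin.
rewrite wE -EFinM.
apply: (@le_trans _ _ (k%:E * ((V J)^-1 * B)%:E `^ (p - 1))%E).
  rewrite lee_wpmul2l ?lee_fin ?(ltW k0) // ge0_le_poweR ?(ltW p1) //.
    by apply: daverage_ge0 => // x; exact: ltW.
  by rewrite /daverage EFinM lee_wpmul2l ?lee_fin ?invr_ge0 ?(ltW (V0 _)).
rewrite /B mulKf ?gt_eqF // poweR_EFin -EFinM lee_fin -powRrM mulVf ?gt_eqF //.
rewrite powRr1 ?divr_ge0 ?powR_ge0 ?(ltW k0) // mulrC divfK //.
by rewrite gt_eqF.
Qed.

Local Notation sup_inv I :=
  ('N[mu]_+oo[(fun x : measurableTypeR R => ((w x)^-1)%:E) \_ (@dyadic_set R I)])%E.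

Lemma bounded_dmaximal_A1b :
  bounded_wL1_weak mu (dmaximal mu N) w -> A1b mu w.
Proof.
move=> [C [C0 hC]].
suff key I J : b_related I J ->
    ((cb mu 1 I J)%:E * daverage mu w I * sup_inv J <= C%:E)%E.
  apply: (@le_lt_trans _ _ C%:E); last exact: ltry.
  by apply: ge_ereal_sup => _ [I [J [IJ ->]]]; exact: key.
move=> IJ; rewrite wE -EFinM; set k := cb mu 1 I J * (W I / V I).
have k0 : 0 < k by rewrite mulr_gt0 ?cb_gt0 ?divr_gt0.
suff sup_le : (sup_inv J <= (C / k)%:E)%E.
  apply: (@le_trans _ _ (k%:E * (C / k)%:E)%E).
    by rewrite lee_wpmul2l ?lee_fin ?(ltW k0).
  by rewrite -EFinM mulrC divfK ?gt_eqF.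
apply: lee_from_real; first by rewrite lee_fin divr_ge0 // ltW.
move=> a; rewrite le0r => /predU1P[-> _|a0 a_lt].
  by rewrite lee_fin divr_ge0 // ltW.
(* As a is below the essential supremum of 1/w on J, E is not null, and w < 1/a on E makes the norm
   of its indicator at most mu(E) / a. *)
pose E := @dyadic_set R J `&` [set x : measurableTypeR R | a < (w x)^-1].
have mE : measurable E.
  apply: measurableI => //.
  rewrite (_ : [set x | _] = [set x | ((- a^-1)%:E < (- w x)%:E)%E]).
    apply: measurable_superlevel; apply/measurable_EFinP.
    exact: measurableT_comp.
  apply/seteqP; split=> x /=; rewrite lte_fin ltrN2 => h.
    by rewrite -[w x]invrK ltf_pV2 ?posrE ?invr_gt0.
  by rewrite -[a]invrK ltf_pV2 ?posrE ?invr_gt0.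
have muE : (0 < mu E)%E.
  rewrite lt_neqAle measure_ge0 andbT; apply/negP => /eqP E0.
  move: a_lt; rewrite ltNge => /negP; apply.
  apply/(sup_inv_leP mu_nondeg w_gt0); first by rewrite lee_fin ltW.
  exists E; split=> // x /= /not_implyP[Jx xa]; split=> //=.
  by rewrite ltNge; apply/negP; rewrite lee_fin in xa.
have muE_fin : (mu E < +oo)%E.
  have /andP[_] := mu_nondeg J; apply: le_lt_trans.
  by apply: le_measure; rewrite ?inE // => x [].
pose e := fine (mu E); have eE : mu E = e%:E by rewrite /e fineK // ge0_fin_numE.
have e0 : 0 < e by apply: fine_gt0; rewrite muE.
pose f x : R := \1_E x.
have mf : measurable_fun [set: measurableTypeR R] (f : measurableTypeR R -> R).
  exact: measurable_indic.
have f0 x : 0 <= f x by [].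
have wf : (wLnorm mu w 1 (EFin \o f) <= (e / a)%:E)%E.
  rewrite /wLnorm invr1 poweRe1; last first.
    by apply: integral_ge0 => x _; rewrite mule_ge0 ?poweR_ge0 // lee_fin ltW.
  apply: (@le_trans _ _ (\int[mu]_(x in E) (a^-1)%:E)%E).
    rewrite [leRHS]integral_mkcond; apply: ge0_le_integral => //.
    - by move=> x _; rewrite mule_ge0 ?poweR_ge0 // lee_fin ltW.
    - apply: emeasurable_funM => //; apply: (measurableT_comp (measurable_poweR 1)).
      by apply: measurableT_comp => //; exact/measurable_EFinP.
    - by apply/(measurable_restrictT _ mE); exact: measurable_cst.
    - move=> x _; rewrite patchE poweRe1 ?abse_ge0 //= /f indicE.
      case: ifPn => xE; last by rewrite normr0 mul0e.
      rewrite normr1 mul1e lee_fin; move: xE; rewrite inE => -[_ /= h].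
      by rewrite ltW // -[w x]invrK ltf_pV2 ?posrE ?invr_gt0.
  by rewrite integral_cst // eE -EFinM mulrC.
pose l := cb mu 1 J I * (e / V J).
have l0 : 0 < l by rewrite mulr_gt0 ?cb_gt0 ?divr_gt0.
have Ml x : @dyadic_set R I x -> (l%:E <= dmaximal mu N f x)%E.
  move=> Ix; have := dmaximal_ge mu_nondeg f (near_related IJ) Ix.
  apply: le_trans; rewrite /l EFinM lee_wpmul2l ?lee_fin ?cb_ge0 //.
  rewrite /daverage mulrC EFinM lee_wpmul2l ?lee_fin ?invr_ge0 ?(ltW (V0 _)) //.
  have -> : (\int[mu]_(x in @dyadic_set R J) (`|f x|)%:E =
      \int[mu]_(x in @dyadic_set R J) (\1_E x)%:E)%E.
    by apply: eq_integral => y _; rewrite ger0_norm.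
  rewrite integral_indic // -eE le_eqVlt; apply/orP; left; apply/eqP; congr (mu _).
  by rewrite setIidl // => y [].
(* The weak quasinorm uses strict superlevel sets, so only t < l is allowed here; [lW] reaches l by
   contradiction at a midpoint. *)
have weak t : 0 < t -> t < l -> t * W I <= C * (e / a).
  move=> t0 tl; rewrite -lee_fin EFinM -WE [leRHS]EFinM.
  apply: (@le_trans _ _ (C%:E * wLnorm mu w 1 (EFin \o f))%E); last first.
    by rewrite lee_wpmul2l ?lee_fin.
  apply: le_trans (hC f _); last first.
    by split=> //; apply: le_lt_trans wf _; exact: ltry.
  apply: le_trans (ereal_sup_ubound _); last by exists t.
  rewrite lee_wpmul2l ?lee_fin ?(ltW t0) //; apply: ge0_subset_integral => //.
  - apply: measurable_superlevel; apply: measurableT_comp => //; exact: measurable_dmaximal.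
  - exact: (measurable_funTS mEw).
  - by move=> x _; rewrite lee_fin ltW.
  - move=> x Ix /=; apply: lt_le_trans (lee_abs _); apply: lt_le_trans (Ml x Ix).
    by rewrite lte_fin.
have lW : l * W I <= C * (e / a).
  rewrite leNgt; apply/negP => h.
  have Cea : 0 <= C * (e / a) by rewrite mulr_ge0 // divr_ge0 // ltW.
  pose t := (l + C * (e / a) / W I) / 2.
  have q0 : 0 <= C * (e / a) / W I by rewrite divr_ge0 // ltW.
  have ql : C * (e / a) / W I < l by rewrite ltr_pdivrMr.
  have := weak t; rewrite -ler_pdivlMr // => /(_ _ _)/implyP.
  by rewrite /t; lra.
rewrite lee_fin ler_pdivlMr //; have := cb_swap I J (@ltr01 R).
rewrite subrr powRr0 divr1 !powRr1 ?(ltW (V0 _)) ?cb_ge0 // => swap.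
have -> : a * k = a / e * (l * W I).
  rewrite /k /l (_ : cb mu 1 I J * (W I / V I) = cb mu 1 I J / V I * W I); last by ring.
  by rewrite swap; field; rewrite !gt_eqF.
rewrite (le_trans (ler_wpM2l _ lW)) ?divr_ge0 ?(ltW a0) ?(ltW e0) //.
rewrite le_eqVlt; apply/orP; left; apply/eqP; field; by rewrite !gt_eqF.
Qed.

End Necessity.

(** * Independence of the representative of the weight *)

Section AlmostEverywhereEqualWeights.
Variables (R : realType) (mu : {measure set (measurableTypeR R) -> \bar R}).
Variables (u w : R -> R) (p : R) (N : nat).
Hypothesis mu_nondeg : dyadic_nondegenerate mu.
Hypothesis m_u : measurable_fun [set: measurableTypeR R] (u : measurableTypeR R -> R).
Hypothesis mw : measurable_fun [set: measurableTypeR R] (w : measurableTypeR R -> R).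
Hypothesis uw : {ae mu, forall x, u x = w x}.
Implicit Types I J : dyadic.

(** F takes both the point and the value of the weight, so that one statement covers weighted norms
    and averages of powers of the weight. *)
Lemma ae_eq_weight_integral (D : set (measurableTypeR R)) (F : R -> R -> \bar R) :
  measurable D ->
  measurable_fun D ((fun x => F x (u x)) : measurableTypeR R -> \bar R) ->
  measurable_fun D ((fun x => F x (w x)) : measurableTypeR R -> \bar R) ->
  (\int[mu]_(x in D) F x (u x) = \int[mu]_(x in D) F x (w x))%E.
Proof.
move=> mD m1 m2; apply: ae_eq_integral => //.
by case: uw => A [mA A0 sA]; exists A; split=> // x /= nx; apply: sA => /= ux; apply: nx; rewrite ux.
Qed.

Let mEu : measurable_fun [set: measurableTypeR R] (EFin \o u : measurableTypeR R -> \bar R).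
Proof. exact/measurable_EFinP. Qed.
Let mEw : measurable_fun [set: measurableTypeR R] (EFin \o w : measurableTypeR R -> \bar R).
Proof. exact/measurable_EFinP. Qed.

Lemma ae_eq_wLnorm q (g : R -> \bar R) :
  measurable_fun [set: measurableTypeR R] (g : measurableTypeR R -> \bar R) ->
  wLnorm mu u q g = wLnorm mu w q g.
Proof.
move=> mg; rewrite /wLnorm; congr (_ `^ _)%E.
have mgq : measurable_fun [set: measurableTypeR R]
    ((fun x => (`|g x| `^ q)%E) : measurableTypeR R -> \bar R).
  by apply: (measurableT_comp (measurable_poweR q)); exact: measurableT_comp.
by apply: (ae_eq_weight_integral (F := fun x v => (`|g x| `^ q * v%:E)%E)) => //;
  exact: emeasurable_funM.
Qed.

Lemma ae_eq_in_wLp q f : in_wLp mu u q f <-> in_wLp mu w q f.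
Proof.
have e : measurable_fun [set: measurableTypeR R] (f : measurableTypeR R -> R) ->
    wLnorm mu u q (EFin \o f) = wLnorm mu w q (EFin \o f).
  by move=> mf; apply: ae_eq_wLnorm; exact/measurable_EFinP.
by split=> -[mf fin]; split=> //; [rewrite -e|rewrite e].
Qed.

Lemma ae_eq_weak_norm (g : R -> \bar R) :
  measurable_fun [set: measurableTypeR R] (g : measurableTypeR R -> \bar R) ->
  wweakL1norm mu u g = wweakL1norm mu w g.
Proof.
move=> mg; rewrite /wweakL1norm; congr ereal_sup.
have e t : (\int[mu]_(x in [set x : measurableTypeR R | (t%:E < `|g x|)%E]) (u x)%:E =
    \int[mu]_(x in [set x : measurableTypeR R | (t%:E < `|g x|)%E]) (w x)%:E)%E.
  apply: (ae_eq_weight_integral (F := fun x v => v%:E)).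
  - by apply: measurable_superlevel; exact: measurableT_comp.
  - exact: (measurable_funTS mEu).
  - exact: (measurable_funTS mEw).
by apply/seteqP; split=> y [t [t0 ->]]; exists t; rewrite e.
Qed.

Lemma ae_eq_bounded_on_wLp : bounded_on_wLp mu (dmaximal mu N) u p ->
  bounded_on_wLp mu (dmaximal mu N) w p.
Proof.
move=> [C [C0 hC]]; exists C; split=> // f /ae_eq_in_wLp fin.
have mEf : measurable_fun [set: measurableTypeR R] (EFin \o f : measurableTypeR R -> \bar R).
  by apply/measurable_EFinP; case: fin.
have := hC f fin; rewrite (ae_eq_wLnorm _ mEf).
by rewrite (ae_eq_wLnorm _ (measurable_dmaximal mu_nondeg N f)).
Qed.

Lemma ae_eq_bounded_wL1_weak : bounded_wL1_weak mu (dmaximal mu N) u ->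
  bounded_wL1_weak mu (dmaximal mu N) w.
Proof.
move=> [C [C0 hC]]; exists C; split=> // f /ae_eq_in_wLp fin.
have mEf : measurable_fun [set: measurableTypeR R] (EFin \o f : measurableTypeR R -> \bar R).
  by apply/measurable_EFinP; case: fin.
have := hC f fin; rewrite (ae_eq_wLnorm _ mEf).
by rewrite (ae_eq_weak_norm (measurable_dmaximal mu_nondeg N f)).
Qed.

Lemma ae_eq_daverage (F : R -> R) I :
  measurable_fun [set: R] F ->
  daverage mu (fun x => F (u x)) I = daverage mu (fun x => F (w x)) I.
Proof.
move=> mF; rewrite /daverage; congr (_ * _)%E.
apply: (ae_eq_weight_integral (F := fun x v => (F v)%:E)).
- exact: measurable_dyadic_set.
- by apply: measurable_funTS; apply/measurable_EFinP; exact: measurableT_comp.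
- by apply: measurable_funTS; apply/measurable_EFinP; exact: measurableT_comp.
Qed.

Lemma ae_eq_Apb : Apb mu p u -> Apb mu p w.
Proof.
apply: le_lt_trans; apply: ereal_sup_le => y [I [J [IJ ->]]].
exists I, J; split; first exact: IJ.
have eI : daverage mu u I = daverage mu w I := ae_eq_daverage I (@measurable_id _ _ _).
have eJ := ae_eq_daverage J (measurable_powR (1 - conjugate_exponent p)).
by rewrite eI eJ.
Qed.

Lemma ae_eq_A1b : A1b mu u -> A1b mu w.
Proof.
apply: le_lt_trans; apply: ereal_sup_le => y [I [J [IJ ->]]].
exists I, J; split; first exact: IJ.
have eI : daverage mu u I = daverage mu w I := ae_eq_daverage I (@measurable_id _ _ _).
rewrite -eI; congr (_ * _)%E; rewrite unlock; case: ifP => // _; apply: ess_sup_inf.eq_ess_sup.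
case: uw => A [mA A0 sA]; exists A; split=> // x /= nx; apply: sA => /= ux.
by apply: nx; rewrite !patchE ux.
Qed.

End AlmostEverywhereEqualWeights.

Section PositiveRepresentative.
Variables (R : realType) (mu : {measure set (measurableTypeR R) -> \bar R}).
Variable w : R -> R.

(** A weight is positive only almost everywhere, while the arguments with its powers and inverses
    are pointwise. The value 1 is put where w is not positive. *)
Lemma weight_positive_representative : weight mu w ->
  exists u, [/\ weight mu u, forall x, 0 < u x & {ae mu, forall x, w x = u x}].
Proof.
move=> [mw w0 wint].
pose A := [set x : measurableTypeR R | (0 < (w x)%:E)%E].
have mA : measurable A by apply: measurable_superlevel; exact/measurable_EFinP.
pose u x := w x * \1_A x + \1_(~` A) x.
have wu : {ae mu, forall x, w x = u x}.
  have [B [mB B0 sB]] := w0; exists B; split=> // x /= ux; apply: sB => /= wx.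
  have Ax : A x by rewrite /A /= lte_fin.
  by apply: ux; rewrite /u !indicE mem_set // memNset ?mulr1 ?addr0.
have u_gt0 x : 0 < u x.
  rewrite /u !indicE; have [Ax|nAx] := pselect (A x).
    by rewrite mem_set // memNset ?mulr1 ?addr0 // -lte_fin.
  by rewrite memNset // mem_set // mulr0 add0r.
have mu_ : measurable_fun [set: measurableTypeR R] (u : measurableTypeR R -> R).
  apply: measurable_funD; last by apply: measurable_indic; exact: measurableC.
  by apply: measurable_funM => //; exact: measurable_indic.
exists u; split=> //.
  split=> //; first by exists set0; split=> // x /=; rewrite u_gt0.
  move=> K cK; have := wint K cK.
  rewrite (ae_eq_weight_integral wu (F := fun x v => `|v|%:E)) //.
  - by apply: closed_measurable; apply: compact_closed => //; exact: Rhausdorff.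
  - by apply: measurable_funTS; apply/measurable_EFinP; exact: measurableT_comp.
  - by apply: measurable_funTS; apply/measurable_EFinP; exact: measurableT_comp.
Qed.

End PositiveRepresentative.

Theorem proposition3p5 (R : realType)
    (mu : {measure set (measurableTypeR R) -> \bar R})
    (w : R -> R) (p : R) (N : nat)
    (mu_nondeg : dyadic_nondegenerate mu)
    (mu_balanced : balanced mu)
    (w_weight : weight mu w)
    (p_gt1 : 1 < p)
    (N_ge1 : (1 <= N)%N) :
  (bounded_on_wLp mu (dmaximal mu N) w p <-> Apb mu p w) /\
  (bounded_wL1_weak mu (dmaximal mu N) w <-> A1b mu w).
Proof.
(* Each implication is proved for the everywhere positive u and transported from and back to w. *)
have [u [u_weight u_gt0 wu]] := weight_positive_representative w_weight.
have uw : {ae mu, forall x, u x = w x} by case: wu => A [mA A0 sA]; exists A; split=> // x /= ux; apply: sA => /= /esym.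
have [mw _ _] := w_weight; have [mu_ _ _] := u_weight.
split; split.
- move=> /(ae_eq_bounded_on_wLp mu_nondeg mw mu_ wu) h.
  exact/(ae_eq_Apb mu_ mw uw)/(bounded_dmaximal_Apb mu_nondeg u_weight u_gt0 N_ge1 p_gt1 h).
- move=> /(ae_eq_Apb mw mu_ wu) h.
  apply: (ae_eq_bounded_on_wLp mu_nondeg mu_ mw uw).
  exact: Apb_bounded_dmaximal.
- move=> /(ae_eq_bounded_wL1_weak mu_nondeg mw mu_ wu) h.
  exact/(ae_eq_A1b mu_ mw uw)/(bounded_dmaximal_A1b mu_nondeg u_weight u_gt0 N_ge1 h).
- move=> /(ae_eq_A1b mw mu_ wu) h.
  apply: (ae_eq_bounded_wL1_weak mu_nondeg mu_ mw uw).
  exact: A1b_bounded_dmaximal.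
Qed.
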